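(* Let $G$ be a finite group, $H\subset G$ a subgroup, $d\in G$, $S=\mathrm{Stab}_H(dH)=H\cap dHd^{-1}$, $W$ a finite-dimensional complex representation of $S$ with character $\eta$, and $\mathcal F_d(W)$ the object of the fusion category ${}^{G}_{H}\mathcal M_{H}$ of $G$-graded $H$-bimodules corresponding to $W$. Then for every integer $m\ge 1$ the $m$-th Frobenius-Schur indicator of $\mathcal F_d(W)$ is $$\nu_m(\mathcal F_d(W))=\frac1{|S|}\sum_{\substack{r\in dH\\ r^m\in S}}\overline{\eta}(r^m)=\frac1{|S|}\sum_{\substack{h\in H\\ (dh)^m\in S}}\overline{\eta}((dh)^m).$$
   Context: All vector spaces and representations are finite-dimensional over $\mathbb C$; $\overline\eta$ denotes the complex conjugate of the character $\eta$. The category ${}^{G}_{H}\mathcal M_{H}$: objects are finite-dimensional $G$-graded complex vector spaces $M=\bigoplus_{g\in G}M_g$ that are $\mathbb CH$-bimodules with $|hmk|=h|m|k$ for $h,k\in H$ and homogeneous $m\in M$ (here $|m|$ is the degree). Morphisms are degree-preserving bimodule maps. The tensor product is $\otimes_{\mathbb CH}$ with $|m\otimes n|=|m||n|$, and the unit object is $\mathbb CH$ with $|h|=h$. This is a fusion category. The functor $\mathcal F_d$: for $d\in G$ let $S=\mathrm{Stab}_H(dH)=H\cap dHd^{-1}$ be the stabilizer of the coset $dH$ under left multiplication by $H$. The full subcategory of those objects $M$ all of whose homogeneous elements have degree in the double coset $HdH$ is equivalent to $\mathrm{Rep}(S)$, via the functor $M\mapsto (M_{dH})/H$, where $M_{dH}=\bigoplus_{g\in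 dH}M_g$, $/H$ denotes the quotient by the right $H$-action (i.e. by the span of all $mk-m$, $k\in H$), and $S$ acts through the left $H$-action. $\mathcal F_d$ denotes the inverse equivalence, regarded as a functor from $\mathrm{Rep}(S)$ to ${}^{G}_{H}\mathcal M_{H}$. Higher Frobenius-Schur indicators: ${}^{G}_{H}\mathcal M_{H}$ carries its canonical pivotal structure $j_V:V\to V^{\vee\vee}$, the one for which the pivotal dimension of every simple object is its Frobenius-Perron dimension. Write $V^\vee$ for the dual of $V$, with evaluation $\mathrm{ev}:V^\vee\otimes V\to I$ and coevaluation $\mathrm{db}_V:I\to V\otimes V^\vee$. For an object $V$ and an integer $m\ge1$, let $E_V^{(m)}$ be the linear endomorphism of $\mathrm{Hom}(I,V^{\otimes m})$ sending $f:I\to V\otimes V^{\otimes (m-1)}$ to $$I\xrightarrow{\mathrm{db}_{V^\vee}}V^\vee\otimes V^{\vee\vee}\xrightarrow{\mathrm{id}\otimes f\otimes \mathrm{id}}V^\vee\otimes V\otimes V^{\otimes(m-1)}\otimes V^{\vee\vee}\xrightarrow{\mathrm{ev}\otimes \mathrm{id}\otimes j_V^{-1}}V^{\otimes(m-1)}\otimes V$$ (it rotates the first tensor factor to the last place; associativity isomorphisms suppressed). The $m$-th indicator is $\nu_m(V):=\mathrm{Tr}(E_V^{(m)})$. *)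

(* Defs.v *)
From HB Require Import structures.
From mathcomp Require Import all_boot all_order all_fingroup all_algebra.
From mathcomp Require Import mxrepresentation complex reals.

Set Implicit Arguments.
Unset Strict Implicit.
Unset Printing Implicit Defensive.

Import GroupScope GRing.Theory Num.Theory.
Local Open Scope ring_scope.

Section LinearFunctions.
Variable C : fieldType.

Lemma linfunE (U V : vectType C) (f : U -> V) :
  linear f -> linfun f =1 f.
Proof.
move=> fL; pose fM := GRing.isLinear.Build _ _ _ _ f fL.
by move=> u; rewrite (lfunE (HB.pack_for {linear U -> V} f fM)).
Qed.

Definition ltrace (U : vectType C) (f : U -> U) : C :=
  \sum_(i < \dim {:U}) coord (vbasis {:U}) i (f (vbasis {:U})`_i).

(* The quotient V / U, realised on a complement of U. *)
Definition quot (V : vectType C) (U : {vspace V}) : vectType C :=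
  subvs_of (U^C)%VS.

Section Quotient.
Variables (V : vectType C) (U : {vspace V}).

Definition quo : 'Hom(V, quot U) :=
  linfun (vsproj (U^C)%VS \o daddv_pi (U^C)%VS U).

Definition quorep : 'Hom(quot U, V) := linfun (@vsval C V (U^C)%VS).

Lemma quoE v : quo v = vsproj (U^C)%VS (daddv_pi (U^C)%VS U v).
Proof. by rewrite lfunE. Qed.

Lemma quorepK x : quo (quorep x) = x.
Proof.
rewrite quoE lfunE /= daddv_pi_id ?vsvalK ?subvsP //.
by rewrite capvC capv_compl.
Qed.

Lemma quo_eq0 v : (quo v == 0) = (v \in U).
Proof.
have UC : ((U^C :&: U) = 0)%VS by rewrite capvC capv_compl.
have UUC : ((U :&: U^C) = 0)%VS by rewrite capv_compl.
rewrite quoE.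
have dv : daddv_pi (U^C)%VS U v + daddv_pi U (U^C)%VS v = v.
  by apply: daddv_pi_add => //; rewrite addvC addv_complf memvf.
apply/eqP/idP => [q0|Uv].
  have /(congr1 vsval) := q0; rewrite vsprojK ?memv_pi //= => d0.
  by rewrite -dv d0 add0r memv_pi.
suff -> : daddv_pi (U^C)%VS U v = 0 by rewrite linear0.
have: daddv_pi (U^C)%VS U v \in (U :&: U^C)%VS.
  rewrite memv_cap memv_pi andbT.
  by rewrite -[X in X \in _](addrK (daddv_pi U (U^C)%VS v)) dv rpredB ?memv_pi.
by rewrite UUC memv0 => /eqP.
Qed.

Lemma quorep_quo v : quorep (quo v) - v \in U.
Proof. by rewrite -quo_eq0 linearB /= quorepK subrr. Qed.

End Quotient.

(* The tensor product over C, in coordinates. *)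
Definition vtens (V W : vectType C) : vectType C :=
  'M[C]_(\dim {:V}, \dim {:W}).

Definition bilin (V W T : vectType C) (f : V -> W -> T) :=
  (forall v, linear (f v)) /\ (forall w, linear (f^~ w)).

Section Bilin.
Variables (V W T : vectType C) (f : V -> W -> T).
Hypothesis fB : bilin f.

Lemma bilin_suml (I : Type) r (P : pred I) (c : I -> C) g w :
  f (\sum_(i <- r | P i) c i *: g i) w = \sum_(i <- r | P i) c i *: f (g i) w.
Proof.
pose F : {linear V -> T} := HB.pack (f^~ w) (GRing.isLinear.Build _ _ _ _ (f^~ w) (fB.2 w)).
rewrite -[f _ w]/(F _) linear_sum; apply: eq_bigr => i _; exact: linearZ.
Qed.

Lemma bilin_sumr (I : Type) r (P : pred I) (c : I -> C) g v :
  f v (\sum_(i <- r | P i) c i *: g i) = \sum_(i <- r | P i) c i *: f v (g i).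
Proof.
pose F : {linear W -> T} := HB.pack (f v) (GRing.isLinear.Build _ _ _ _ (f v) (fB.1 v)).
rewrite -[f v _]/(F _) linear_sum; apply: eq_bigr => i _; exact: linearZ.
Qed.

End Bilin.

Section Tensor.
Variables V W : vectType C.

Definition pure (v : V) (w : W) : vtens V W :=
  \matrix_(i, j) (coord (vbasis {:V}) i v * coord (vbasis {:W}) j w).

Definition vtens_lift (T : vectType C) (f : V -> W -> T) : 'Hom(vtens V W, T) :=
  linfun (fun A : vtens V W =>
    \sum_i \sum_j A i j *: f (vbasis {:V})`_i (vbasis {:W})`_j).

Lemma pure_bilin : bilin pure.
Proof.
split=> [v k w w'|w k v v']; apply/matrixP => i j; rewrite !mxE linearP /=.
  by rewrite mulrDr mulrCA.
by rewrite mulrDl mulrA.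
Qed.

Variables (T : vectType C).

Lemma vtens_liftE (f : V -> W -> T) v w :
  bilin f -> vtens_lift f (pure v w) = f v w.
Proof.
move=> fB; rewrite /vtens_lift linfunE; last first.
  move=> k A B; rewrite scaler_sumr -big_split; apply: eq_bigr => i _ /=.
  rewrite scaler_sumr -big_split; apply: eq_bigr => j _ /=.
  by rewrite !mxE scalerDl scalerA.
rewrite [in RHS](coord_vbasis (memvf v)) (bilin_suml fB).
apply: eq_bigr => i _; rewrite [in RHS](coord_vbasis (memvf w)) (bilin_sumr fB).
by rewrite scaler_sumr; apply: eq_bigr => j _; rewrite mxE scalerA.
Qed.

Lemma vtens_ext (f g : 'Hom(vtens V W, T)) :
  (forall v w, f (pure v w) = g (pure v w)) -> f = g.
Proof.
move=> fg; apply/lfunP => A.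
have -> : A = \sum_i \sum_j A i j *: pure (vbasis {:V})`_i (vbasis {:W})`_j.
  rewrite [LHS]matrix_sum_delta; apply: eq_bigr => i _; apply: eq_bigr => j _.
  congr (_ *: _); apply/matrixP => k l; rewrite !mxE.
  by rewrite !coord_free ?(basis_free (vbasisP _)) // -natrM mulnb !(eq_sym k) !(eq_sym l).
rewrite (linear_sum f) (linear_sum g); apply: eq_bigr => i _.
rewrite (linear_sum f) (linear_sum g); apply: eq_bigr => j _.
by rewrite !linearZ /= fg.
Qed.

End Tensor.
End LinearFunctions.

(* Operations of a C-linear monoidal category in which every object V has a
   dual: ev : V^v (x) V -> 1 and db : 1 -> V (x) V^v.  The primed maps are the
   inverses of the associativity and unit isomorphisms. *)
Record monData (C : fieldType) := MonData {
  obj :> Type;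
  mhom : obj -> obj -> vectType C;
  idm : forall V, mhom V V;
  cmp : forall U V W, mhom V W -> mhom U V -> mhom U W;
  munit : obj;
  tens : obj -> obj -> obj;
  tensm : forall V V' W W',
    mhom V V' -> mhom W W' -> mhom (tens V W) (tens V' W');
  asc : forall U V W, mhom (tens (tens U V) W) (tens U (tens V W));
  asc' : forall U V W, mhom (tens U (tens V W)) (tens (tens U V) W);
  lun : forall V, mhom (tens munit V) V;
  lun' : forall V, mhom V (tens munit V);
  run : forall V, mhom (tens V munit) V;
  run' : forall V, mhom V (tens V munit);
  dual : obj -> obj;
  ev : forall V, mhom (tens (dual V) V) munit;
  db : forall V, mhom munit (tens V (dual V))
}.

Arguments idm {C m} V.
Arguments cmp {C m U V W} g f : rename.
Arguments munit {C m}.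
Arguments tensm {C m V V' W W'} f g : rename.
Arguments asc {C m} U V W.
Arguments asc' {C m} U V W.
Arguments lun {C m} V.
Arguments lun' {C m} V.
Arguments run {C m} V.
Arguments run' {C m} V.
Arguments dual {C m} V.
Arguments ev {C m} V.
Arguments db {C m} V.

Declare Scope mon_scope.
Delimit Scope mon_scope with mon.
Notation "g ∘ f" := (cmp g f) (at level 50, left associativity) : mon_scope.
Notation "V ⊗ W" := (tens V W) (at level 40, left associativity) : mon_scope.
Notation "f ⊠ g" := (tensm f g) (at level 40, left associativity) : mon_scope.
Notation "V ^∨" := (dual V) (at level 2, left associativity, format "V ^∨") : mon_scope.
Local Open Scope mon_scope.

Record rigidLaws (C : fieldType) (D : monData C) : Prop := RigidLaws {
  cmpA : forall (U V W X : D) (h : mhom W X) (g : mhom V W) (f : mhom U V),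
    h ∘ (g ∘ f) = h ∘ g ∘ f;
  cmp1m : forall (U V : D) (f : mhom U V), idm V ∘ f = f;
  cmpm1 : forall (U V : D) (f : mhom U V), f ∘ idm U = f;
  cmp_bilin : forall U V W : D, bilin (@cmp C D U V W);
  tensm1 : forall V W : D, idm V ⊠ idm W = idm (V ⊗ W);
  tensm_cmp : forall (V V' V'' W W' W'' : D) (f' : mhom V' V'') (f : mhom V V')
      (g' : mhom W' W'') (g : mhom W W'),
    (f' ∘ f) ⊠ (g' ∘ g) = (f' ⊠ g') ∘ (f ⊠ g);
  tensm_bilin : forall V V' W W' : D, bilin (@tensm C D V V' W W');
  ascK : forall U V W : D, asc' U V W ∘ asc U V W = idm _;
  asc'K : forall U V W : D, asc U V W ∘ asc' U V W = idm _;
  lunK : forall V : D, lun' V ∘ lun V = idm _;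
  lun'K : forall V : D, lun V ∘ lun' V = idm _;
  runK : forall V : D, run' V ∘ run V = idm _;
  run'K : forall V : D, run V ∘ run' V = idm _;
  asc_nat : forall (U U' V V' W W' : D)
      (f : mhom U U') (g : mhom V V') (h : mhom W W'),
    asc U' V' W' ∘ (f ⊠ g ⊠ h) = (f ⊠ (g ⊠ h)) ∘ asc U V W;
  lun_nat : forall (V V' : D) (f : mhom V V'),
    lun V' ∘ (idm munit ⊠ f) = f ∘ lun V;
  run_nat : forall (V V' : D) (f : mhom V V'),
    run V' ∘ (f ⊠ idm munit) = f ∘ run V;
  pentagon : forall U V W X : D,
    asc U V (W ⊗ X) ∘ asc (U ⊗ V) W X =
    (idm U ⊠ asc V W X) ∘ asc U (V ⊗ W) X ∘ (asc U V W ⊠ idm X);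
  triangle : forall V W : D,
    (idm V ⊠ lun W) ∘ asc V munit W = run V ⊠ idm W;
  zigzag : forall V : D,
    run V ∘ (idm V ⊠ ev V) ∘ asc V V^∨ V ∘ (db V ⊠ idm V) ∘ lun' V = idm V;
  zigzag_dual : forall V : D,
    lun V^∨ ∘ (ev V ⊠ idm V^∨) ∘ asc' V^∨ V V^∨ ∘ (idm V^∨ ⊠ db V) ∘ run' V^∨
    = idm V^∨
}.

Record rigidCat (C : fieldType) := RigidCat {
  rigid_data :> monData C;
  rigid_laws : rigidLaws rigid_data
}.

Section Duality.
Variables (C : fieldType) (D : rigidCat C).
Implicit Types U V W X Y : D.

Definition dualm V W (f : mhom V W) : mhom W^∨ V^∨ :=
  lun V^∨ ∘ (ev W ⊠ idm V^∨) ∘ asc' W^∨ W V^∨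
  ∘ (idm W^∨ ⊠ ((f ⊠ idm V^∨) ∘ db V)) ∘ run' W^∨.

(* The canonical map W^v (x) V^v -> (V (x) W)^v, through the nested evaluation
   W^v (x) V^v (x) V (x) W -> 1. *)
Definition is_dual_tens V W (c : mhom (W^∨ ⊗ V^∨) (V ⊗ W)^∨) : Prop :=
  ev (V ⊗ W) ∘ (c ⊠ idm (V ⊗ W)) =
  ev W ∘ (idm W^∨ ⊠ (lun W ∘ (ev V ⊠ idm W) ∘ asc' V^∨ V W))
  ∘ asc W^∨ V^∨ (V ⊗ W).

Record pivotal := Pivotal {
  piv : forall V, mhom V V^∨^∨;
  piv' : forall V, mhom V^∨^∨ V;
  pivK : forall V, piv' V ∘ piv V = idm V;
  piv'K : forall V, piv V ∘ piv' V = idm V^∨^∨;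
  piv_nat : forall V W (f : mhom V W), piv W ∘ f = dualm (dualm f) ∘ piv V;
  piv_tens : forall V W (c : mhom (W^∨ ⊗ V^∨) (V ⊗ W)^∨)
      (c' : mhom (V^∨^∨ ⊗ W^∨^∨) (W^∨ ⊗ V^∨)^∨),
    is_dual_tens c -> is_dual_tens c' ->
    dualm c ∘ piv (V ⊗ W) = c' ∘ (piv V ⊠ piv W)
}.

Definition is_pivdim (j : pivotal) V (a : C) : Prop :=
  ev V^∨ ∘ (piv j V ⊠ idm V^∨) ∘ db V = a *: idm munit.

Fixpoint tpow V n : D := if n is k.+1 then V ⊗ tpow V k else munit.

Fixpoint tpow_rot V n : mhom (tpow V n ⊗ V) (V ⊗ tpow V n) :=
  if n is k.+1 then (idm V ⊠ tpow_rot V k) ∘ asc V (tpow V k) V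
  else run' V ∘ lun V.

Definition FS_map (j : pivotal) V n (f : mhom munit (tpow V n.+1)) :
    mhom munit (tpow V n.+1) :=
  tpow_rot V n
  ∘ (idm (tpow V n) ⊠ piv' j V)
  ∘ lun (tpow V n ⊗ V^∨^∨)
  ∘ (ev V ⊠ idm (tpow V n ⊗ V^∨^∨))
  ∘ asc' V^∨ V (tpow V n ⊗ V^∨^∨)
  ∘ (idm V^∨ ⊠ asc V (tpow V n) V^∨^∨)
  ∘ (idm V^∨ ⊠ (f ⊠ idm V^∨^∨))
  ∘ (idm V^∨ ⊠ lun' V^∨^∨)
  ∘ db V^∨.

Lemma FS_map_linear j V n : linear (@FS_map j V n).
Proof.
have L := rigid_laws D.
move=> a f g; rewrite /FS_map.
have tl := (tensm_bilin L _ _ _ _).2 (idm V^∨^∨).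
have tr := fun U W X : D => (tensm_bilin L U U W X).1 (idm U).
have cr := fun (X Y Z : D) (h : mhom Y Z) => (cmp_bilin L X Y Z).1 h.
have cl := fun (X Y Z : D) (h : mhom X Y) => (cmp_bilin L X Y Z).2 h.
by rewrite tl tr !(cr, cl).
Qed.

(* nu_m for m >= 1; the value at m = 0 is irrelevant. *)
Definition FS_indicator (j : pivotal) m V : C := ltrace (@FS_map j V m.-1).

Definition iso_obj V W : Prop :=
  exists (f : mhom V W) (g : mhom W V), g ∘ f = idm V /\ f ∘ g = idm W.

Definition mono_mor V W (f : mhom V W) : Prop :=
  forall U (g h : mhom U V), f ∘ g = f ∘ h -> g = h.

Definition simple_obj V : Prop :=
  idm V <> 0 /\
  forall U (f : mhom U V), mono_mor f ->
    f = 0 \/ exists g : mhom V U, g ∘ f = idm U /\ f ∘ g = idm V.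

Definition simple_reps n (X : 'I_n -> D) : Prop :=
  [/\ forall i, simple_obj (X i),
      forall i k, iso_obj (X i) (X k) -> i = k
    & forall V, simple_obj V -> exists i, iso_obj V (X i)].

(* The matrix of left multiplication by V on the Grothendieck ring in the basis
   of simple objects: its (i, k) entry is the multiplicity of X i in V (x) X k,
   which is dim Hom(V (x) X k, X i) in a semisimple category. *)
Definition fusion_mx n (X : 'I_n -> D) V : 'M[C]_n :=
  \matrix_(i, k) (\dim {: mhom (V ⊗ X k) (X i)})%:R.
End Duality.

Section FrobeniusPerron.
Variables (C : numFieldType) (D : rigidCat C).

(* The Frobenius-Perron dimension: the largest nonnegative (hence real)
   eigenvalue of the fusion matrix. *)
Definition is_FPdim (V : D) (a : C) : Prop :=
  exists n (X : 'I_n -> D),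
    [/\ simple_reps X, 0 <= a, eigenvalue (fusion_mx X V) a
      & forall b, 0 <= b -> eigenvalue (fusion_mx X V) b -> b <= a].

Definition canonical_pivotal (j : pivotal D) : Prop :=
  forall V : D, simple_obj V -> exists2 a, is_FPdim V a & is_pivdim j V a.
End FrobeniusPerron.

(* A G-graded CH-bimodule; subg_of H is H as a group in its own right. *)
Record gbim (C : fieldType) (gT : finGroupType) (H : {group gT}) := Gbim {
  gsort :> vectType C;
  homog : gT -> {vspace gsort};
  lact : subg_of H -> 'End(gsort);
  ract : subg_of H -> 'End(gsort);
  homog_full : (\sum_g homog g = {:gsort})%VS;
  homog_direct : directv (\sum_g homog g);
  lact1 : forall v, lact 1%g v = v;
  lactM : forall h k v, lact (h * k)%g v = lact h (lact k v);
  ract1 : forall v, ract 1%g v = v;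
  ractM : forall h k v, ract (h * k)%g v = ract k (ract h v);
  lractC : forall h k v, ract k (lact h v) = lact h (ract k v);
  lact_homog : forall h g v,
    v \in homog g -> lact h v \in homog (sgval h * g)%g;
  ract_homog : forall h g v,
    v \in homog g -> ract h v \in homog (g * sgval h)%g
}.

Arguments gsort {C gT H} _ : simpl never.
Arguments homog {C gT H} _ _ : simpl never.
Arguments lact {C gT H} _ _ : simpl never.
Arguments ract {C gT H} _ _ : simpl never.

Section GradedBimodules.
Variables (C : fieldType) (gT : finGroupType) (H : {group gT}).
Local Notation K := (subg_of H).
Local Notation gbim := (gbim C H).
Implicit Types M N P : gbim.

Definition gcomp M g : 'End(M) := sumv_pi (\sum_x homog M x)%VS g.

Lemma gcomp_in M g v : gcomp M g v \in homog M g.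
Proof. exact: memv_sum_pi. Qed.

Lemma gcomp_sum M v : \sum_g gcomp M g v = v.
Proof. by apply: sumv_pi_sum; rewrite homog_full memvf. Qed.

Lemma gcomp_unique M v (u : gT -> M) :
  (forall g, u g \in homog M g) -> \sum_g u g = v -> forall g, gcomp M g v = u g.
Proof.
move=> uh us g; have := homog_direct M => /directv_sum_unique /(_ u (fun g => gcomp M g v)).
move=> /(_ (fun i _ => uh i) (fun i _ => gcomp_in i v)).
rewrite us gcomp_sum eqxx => /esym /forallP /(_ g) /=.
by move=> /eqP.
Qed.

Lemma gcompE M g x v :
  v \in homog M x -> gcomp M g v = if g == x then v else 0.
Proof.
move=> vx; apply: (gcomp_unique (u := fun g => if g == x then v else 0)).
  by move=> y; case: eqP => [->|_] //; exact: mem0v.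
by rewrite -big_mkcond big_pred1_eq.
Qed.

Lemma gcomp_id M g v : (v \in homog M g) = (gcomp M g v == v).
Proof.
apply/idP/eqP => [/gcompE ->|<-]; [by rewrite eqxx | exact: gcomp_in].
Qed.

Lemma gcomp_lact M g h v :
  gcomp M (sgval h * g)%g (lact M h v) = lact M h (gcomp M g v).
Proof.
rewrite (gcomp_unique (u := fun x => lact M h (gcomp M (sgval h^-1 * x)%g v))).
- by rewrite mulKg.
- move=> x; have /(lact_homog h) := gcomp_in (sgval h^-1 * x)%g v.
  by rewrite mulKVg.
rewrite -linear_sum; congr (lact _ _ _); rewrite -[RHS]gcomp_sum.
by rewrite [RHS](reindex_inj (mulgI (sgval h^-1)%g)).
Qed.

Lemma gcomp_ract M g h v :
  gcomp M (g * sgval h)%g (ract M h v) = ract M h (gcomp M g v).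
Proof.
rewrite (gcomp_unique (u := fun x => ract M h (gcomp M (x * sgval h^-1)%g v))).
- by rewrite mulgK.
- move=> x; have /(ract_homog h) := gcomp_in (x * sgval h^-1)%g v.
  by rewrite mulgKV.
rewrite -linear_sum; congr (ract _ _ _); rewrite -[RHS]gcomp_sum.
by rewrite [RHS](reindex_inj (mulIg (sgval h^-1)%g)).
Qed.

Section Factory.
Variables (V : vectType C) (p : gT -> 'End(V)) (l r : K -> 'End(V)).
Hypotheses (p_sum : forall v, \sum_g p g v = v)
  (pp : forall g x v, p g (p x v) = if g == x then p x v else 0)
  (l1 : forall v, l 1%g v = v)
  (lM : forall h k v, l (h * k)%g v = l h (l k v))
  (r1 : forall v, r 1%g v = v)
  (rM : forall h k v, r (h * k)%g v = r k (r h v))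
  (lrC : forall h k v, r k (l h v) = l h (r k v))
  (pl : forall g h v, p (sgval h * g)%g (l h v) = l h (p g v))
  (pr : forall g h v, p (g * sgval h)%g (r h v) = r h (p g v)).

Lemma limg_pP g v : (v \in limg (p g)) = (p g v == v).
Proof.
apply/memv_imgP/eqP => [[u _ ->]|pv]; first by rewrite pp eqxx.
by exists v; rewrite ?memvf.
Qed.

Lemma p_full : (\sum_g limg (p g) = {:V})%VS.
Proof.
apply/eqP; rewrite eqEsubv subvf; apply/subvP => v _.
by rewrite -[v]p_sum memv_sumr // => g _; rewrite memv_img ?memvf.
Qed.

Lemma p_direct : directv (\sum_g limg (p g)).
Proof.
apply/directv_sum_independent => us us_in us0 g _.
have /eqP <- : p g (us g) == us g by rewrite -limg_pP us_in.
have := congr1 (p g) us0; rewrite linear0 linear_sum (bigD1 g) //= big1 ?addr0 //.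
move=> i ig; have /eqP <- : p i (us i) == us i by rewrite -limg_pP us_in.
by rewrite pp eq_sym (negPf ig).
Qed.

Lemma p_lact h g v : v \in limg (p g) -> l h v \in limg (p (sgval h * g)%g).
Proof. by rewrite !limg_pP pl => /eqP->. Qed.

Lemma p_ract h g v : v \in limg (p g) -> r h v \in limg (p (g * sgval h)%g).
Proof. by rewrite !limg_pP pr => /eqP->. Qed.

(* The bimodule whose homogeneous component of degree g is the image of p g. *)
Definition mk_gbim : gbim :=
  Gbim p_full p_direct l1 lM r1 rM lrC p_lact p_ract.

Lemma mk_gcomp g v : gcomp mk_gbim g v = p g v.
Proof.
apply: (@gcomp_unique mk_gbim v (fun g => p g v)) => [x|]; last exact: p_sum.
by rewrite limg_pP pp eqxx.
Qed.
End Factory.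

Definition is_mor M N (f : M -> N) : Prop :=
  [/\ forall h v, f (lact M h v) = lact N h (f v),
      forall h v, f (ract M h v) = ract N h (f v)
    & forall g v, v \in homog M g -> f v \in homog N g].

Definition commutant M N (a : 'End(M)) (b : 'End(N)) : {vspace 'Hom(M, N)} :=
  lker (linfun (fun f : 'Hom(M, N) => (f \o a)%VF - (b \o f)%VF)).

Lemma commutantP M N (a : 'End(M)) (b : 'End(N)) f :
  f \in commutant a b <-> forall v, f (a v) = b (f v).
Proof.
rewrite memv_ker linfunE; last first.
  move=> k u v; rewrite comp_lfunDl comp_lfunDr -comp_lfunZl -comp_lfunZr.
  by rewrite scalerBr opprD addrACA.
rewrite subr_eq0; split=> [/eqP/lfunP fab v|fab].
  by have := fab v; rewrite !comp_lfunE.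
by apply/eqP/lfunP => v; rewrite !comp_lfunE.
Qed.

(* The degree-preserving bimodule maps; see homspaceP. *)
Definition homspace M N : {vspace 'Hom(M, N)} :=
  (\bigcap_h commutant (lact M h) (lact N h)
   :&: \bigcap_h commutant (ract M h) (ract N h)
   :&: \bigcap_g commutant (gcomp M g) (gcomp N g))%VS.

Lemma memv_bigcap (V : vectType C) (I : finType) (Us : I -> {vspace V}) v :
  v \in (\bigcap_i Us i)%VS <-> forall i, v \in Us i.
Proof.
rewrite memvE; split=> [/subv_bigcapP vU i|vU]; first by rewrite memvE vU.
by apply/subv_bigcapP => i _; rewrite -memvE.
Qed.

Lemma homspaceP M N (f : 'Hom(M, N)) : f \in homspace M N <-> is_mor f.
Proof.
rewrite !memv_cap; split=> [/andP[/andP[/memv_bigcap fl /memv_bigcap fr]] |].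
  move=> /memv_bigcap fg; split=> [h v|h v|g v].
  - by have /commutantP/(_ v) := fl h.
  - by have /commutantP/(_ v) := fr h.
  have /commutantP fgE := fg g.
  by rewrite !gcomp_id => /eqP vg; rewrite -fgE vg.
move=> [fl fr fg]; apply/andP; split; first apply/andP; first split.
- by apply/memv_bigcap => h; apply/commutantP/fl.
- by apply/memv_bigcap => h; apply/commutantP/fr.
apply/memv_bigcap => g; apply/commutantP => v; apply/esym.
apply: (gcomp_unique (u := fun x => f (gcomp M x v))) => [x|].
  exact/fg/gcomp_in.
by rewrite -linear_sum gcomp_sum.
Qed.

Definition ghom M N : vectType C := subvs_of (homspace M N).

Definition gfun M N (f : ghom M N) : 'Hom(M, N) := vsval f.
End GradedBimodules.

Arguments gfun {C gT H M N} f : simpl never.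

Section BilinearTools.
Variables (C : fieldType) (V W T : vectType C) (f : V -> W -> T).

Lemma bilin_comp (V' W' : vectType C) (a : 'Hom(V', V)) (b : 'Hom(W', W)) :
  bilin f -> bilin (fun v w => f (a v) (b w)).
Proof. by case=> fr fl; split=> [v k x y|w k x y]; rewrite linearP ?fr ?fl. Qed.

Lemma bilin_post (T' : vectType C) (c : 'Hom(T, T')) :
  bilin f -> bilin (fun v w => c (f v w)).
Proof. by case=> fr fl; split=> [v k x y|w k x y]; rewrite ?fr ?fl linearP. Qed.

End BilinearTools.

Lemma bilin_sum (C : fieldType) (V W T : vectType C) (I : finType)
    (F : I -> V -> W -> T) :
  (forall i, bilin (F i)) -> bilin (fun v w => \sum_i F i v w).
Proof.
move=> FB; split=> [v k x y|w k x y]; rewrite scaler_sumr -big_split;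
  apply: eq_bigr => i _; have [fr fl] := FB i; by rewrite ?fr ?fl.
Qed.

Section Constructions.
Variables (C : fieldType) (gT : finGroupType) (H : {group gT}).
Local Notation K := (subg_of H).
Local Notation gbim := (gbim C H).
Implicit Types M N P : gbim.

Section Morphisms.
Variables (M N : gbim) (f : 'Hom(M, N)).
Definition mk_mor (fM : is_mor f) : ghom M N := Subvs ((homspaceP f).2 fM).
Lemma mk_morE (fM : is_mor f) v : gfun (mk_mor fM) v = f v.
Proof. by []. Qed.
End Morphisms.

Lemma gfunP M N (f : ghom M N) : is_mor (gfun f).
Proof. exact/homspaceP/subvsP. Qed.

Lemma ghomP M N (f g : ghom M N) : gfun f =1 gfun g -> f = g.
Proof. by move=> fg; apply/val_inj/lfunP. Qed.

Lemma id_is_mor M : is_mor (\1%VF : 'End(M)).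
Proof. by split=> [h v|h v|g v]; rewrite !id_lfunE. Qed.

Definition gid M : ghom M M := mk_mor (id_is_mor M).

Lemma cmp_is_mor M N P (g : ghom N P) (f : ghom M N) :
  is_mor (gfun g \o gfun f)%VF.
Proof.
have [fl fr fh] := gfunP f; have [gl gr gh] := gfunP g.
split=> [h v|h v|x v]; rewrite !comp_lfunE ?fl ?gl ?fr ?gr //.
by move/fh/gh.
Qed.

Definition gcmp M N P (g : ghom N P) (f : ghom M N) : ghom M P :=
  mk_mor (cmp_is_mor g f).

Lemma gidE M v : gfun (gid M) v = v. Proof. exact: id_lfunE. Qed.
Lemma gcmpE M N P (g : ghom N P) (f : ghom M N) v :
  gfun (gcmp g f) v = gfun g (gfun f v).
Proof. exact: comp_lfunE. Qed.

(* The unit object CH, as functions on H, in degree |h| = h. *)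
Section Unit.
Local Notation CH := {ffun K -> C^o}.

Definition uproj (g : gT) : 'End(CH) :=
  linfun (fun a : CH => [ffun h => if sgval h == g then a h else 0]).
Definition ulact (k : K) : 'End(CH) :=
  linfun (fun a : CH => [ffun h => a (k^-1 * h)%g]).
Definition uract (k : K) : 'End(CH) :=
  linfun (fun a : CH => [ffun h => a (h * k^-1)%g]).

Lemma uprojE g (a : CH) h : uproj g a h = if sgval h == g then a h else 0.
Proof.
rewrite linfunE ?ffunE // => k u v; apply/ffunP => x; rewrite !ffunE.
by case: ifP; rewrite // scaler0 addr0.
Qed.
Lemma ulactE k (a : CH) h : ulact k a h = a (k^-1 * h)%g.
Proof. by rewrite linfunE ?ffunE // => c u v; apply/ffunP => x; rewrite !ffunE. Qed.
Lemma uractE k (a : CH) h : uract k a h = a (h * k^-1)%g.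
Proof. by rewrite linfunE ?ffunE // => c u v; apply/ffunP => x; rewrite !ffunE. Qed.

Lemma uproj_sum (a : CH) : \sum_g uproj g a = a.
Proof.
apply/ffunP => h; rewrite sum_ffunE (bigD1 (sgval h)) //= uprojE eqxx.
rewrite big1 ?addr0 // => g gh; by rewrite uprojE eq_sym (negPf gh).
Qed.

Lemma uprojM g x (a : CH) : uproj g (uproj x a) = if g == x then uproj x a else 0.
Proof.
apply/ffunP => h; rewrite !uprojE; case: (eqVneq (sgval h) g) => [<-|hg].
  by case: (eqVneq (sgval h) x) => [<-|hx]; rewrite ?uprojE ?eqxx // ffunE.
by case: (eqVneq g x) => [<-|gx]; rewrite ?uprojE ?(negPf hg) // ffunE.
Qed.

Lemma ulact1 (a : CH) : ulact 1%g a = a.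
Proof. by apply/ffunP => h; rewrite ulactE invg1 mul1g. Qed.
Lemma ulactM h k (a : CH) : ulact (h * k)%g a = ulact h (ulact k a).
Proof. by apply/ffunP => x; rewrite !ulactE invMg mulgA. Qed.
Lemma uract1 (a : CH) : uract 1%g a = a.
Proof. by apply/ffunP => h; rewrite uractE invg1 mulg1. Qed.
Lemma uractM h k (a : CH) : uract (h * k)%g a = uract k (uract h a).
Proof. by apply/ffunP => x; rewrite !uractE invMg mulgA. Qed.
Lemma ulractC h k (a : CH) : uract k (ulact h a) = ulact h (uract k a).
Proof. by apply/ffunP => x; rewrite uractE !ulactE uractE mulgA. Qed.
Lemma uproj_lact g h (a : CH) :
  uproj (sgval h * g)%g (ulact h a) = ulact h (uproj g a).
Proof.
apply/ffunP => x; rewrite uprojE !ulactE uprojE.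
by rewrite -(inj_eq (mulgI (sgval h^-1)%g)) mulKg.
Qed.
Lemma uproj_ract g h (a : CH) :
  uproj (g * sgval h)%g (uract h a) = uract h (uproj g a).
Proof.
apply/ffunP => x; rewrite uprojE !uractE uprojE.
by rewrite -(inj_eq (mulIg (sgval h^-1)%g)) mulgK.
Qed.

Definition gunit : gbim :=
  mk_gbim uproj_sum uprojM ulact1 ulactM uract1 uractM ulractC
    uproj_lact uproj_ract.

Lemma gunit_homog g (a : gunit) :
  a \in homog gunit g <-> (forall h, sgval h != g -> (a : CH) h = 0).
Proof.
rewrite gcomp_id mk_gcomp; split=> [/eqP <- h /negPf hg|az].
  by rewrite uprojE hg.
apply/eqP/ffunP => h; rewrite uprojE; case: eqVneq => // hg.
by rewrite az.
Qed.
End Unit.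

(* M (x)_CH N: the quotient of M (x) N by the span of all mh (x) n - m (x) hn. *)
Section Tensor.
Variables M N : gbim.

Definition tens_rel : {vspace vtens M N} :=
  (\sum_h limg (vtens_lift (fun v w =>
     pure (ract M h v) w - pure v (lact N h w))))%VS.

Definition btens : vectType C := quot tens_rel.

Definition bt (v : M) (w : N) : btens := quo tens_rel (pure v w).

Definition blift (T : vectType C) (f : M -> N -> T) : 'Hom(btens, T) :=
  (vtens_lift f \o quorep tens_rel)%VF.

Lemma bt_bilin : bilin bt.
Proof. exact/bilin_post/pure_bilin. Qed.

Lemma btDl v v' w : bt (v + v') w = bt v w + bt v' w.
Proof. by rewrite -[v]scale1r bt_bilin.2 !scale1r. Qed.
Lemma btDr v w w' : bt v (w + w') = bt v w + bt v w'.
Proof. by rewrite -[w]scale1r bt_bilin.1 !scale1r. Qed.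
Lemma bt0l w : bt 0 w = 0.
Proof. by apply: (addIr (bt 0 w)); rewrite -btDl !add0r. Qed.
Lemma bt0r v : bt v 0 = 0.
Proof. by apply: (addIr (bt v 0)); rewrite -btDr !add0r. Qed.
Lemma btZl a v w : bt (a *: v) w = a *: bt v w.
Proof. by rewrite -[a *: v]addr0 bt_bilin.2 bt0l addr0. Qed.
Lemma btZr a v w : bt v (a *: w) = a *: bt v w.
Proof. by rewrite -[a *: w]addr0 bt_bilin.1 bt0r addr0. Qed.
Lemma bt_suml (I : Type) r (Q : pred I) (g : I -> M) w :
  bt (\sum_(i <- r | Q i) g i) w = \sum_(i <- r | Q i) bt (g i) w.
Proof. exact: (big_morph (bt^~ w) (fun x y => btDl x y w) (bt0l w)). Qed.
Lemma bt_sumr (I : Type) r (Q : pred I) (g : I -> N) v :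
  bt v (\sum_(i <- r | Q i) g i) = \sum_(i <- r | Q i) bt v (g i).
Proof. exact: (big_morph (bt v) (btDr v) (bt0r v)). Qed.

Lemma tens_rel_bilin h :
  bilin (fun v w => pure (ract M h v) w - pure v (lact N h w)).
Proof.
have [pr pl] := pure_bilin M N.
split=> [v k x y|w k x y]; rewrite !linearP ?pr ?pl;
by rewrite scalerBr opprD addrACA.
Qed.

Lemma bt_bal h v w : bt (ract M h v) w = bt v (lact N h w).
Proof.
apply/eqP; rewrite -subr_eq0 -linearB /= quo_eq0.
apply: (subvP (sumv_sup h _ (subvv _))) => //.
rewrite -(vtens_liftE v w (tens_rel_bilin h)).
by rewrite memv_img ?memvf.
Qed.

Lemma bliftE (T : vectType C) (f : M -> N -> T) v w :
  bilin f -> (forall h v w, f (ract M h v) w = f v (lact N h w)) ->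
  blift f (bt v w) = f v w.
Proof.
move=> fB fbal; rewrite comp_lfunE -[RHS](vtens_liftE v w fB).
apply/eqP; rewrite -subr_eq0 -linearB /= -memv_ker.
suff /subvP : (tens_rel <= lker (vtens_lift f))%VS by apply; exact: quorep_quo.
apply/subv_sumP => h _; apply/subvP => _ /memv_imgP[A _ ->].
rewrite memv_ker -comp_lfunE; apply/eqP.
rewrite -[RHS](zero_lfunE T A); congr (fun_of_lfun _ A).
apply: vtens_ext => v' w'; rewrite comp_lfunE (vtens_liftE _ _ (tens_rel_bilin h)).
by rewrite linearB /= !vtens_liftE // fbal subrr zero_lfunE.
Qed.

Lemma bt_ext (T : vectType C) (f g : 'Hom(btens, T)) :
  (forall v w, f (bt v w) = g (bt v w)) -> f =1 g.
Proof.
move=> fg x; have /lfunP/(_ (quorep _ x)) :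
    (f \o quo tens_rel = g \o quo tens_rel)%VF.
  by apply: vtens_ext => v w; rewrite !comp_lfunE; exact: fg.
by rewrite !comp_lfunE quorepK.
Qed.

Lemma bt_span (x : btens) :
  x = \sum_i \sum_j (quorep tens_rel x : 'M_(_, _)) i j
        *: bt (vbasis {:M})`_i (vbasis {:N})`_j.
Proof.
pose F : 'Hom(vtens M N, btens) := vtens_lift bt.
have FE : F = quo tens_rel.
  by apply: vtens_ext => v w; rewrite vtens_liftE //; exact: bt_bilin.
rewrite -[LHS]quorepK -FE /F /vtens_lift linfunE //.
move=> k A B; rewrite scaler_sumr -big_split; apply: eq_bigr => i _ /=.
rewrite scaler_sumr -big_split; apply: eq_bigr => j _ /=.
by rewrite !mxE scalerDl scalerA.
Qed.

Lemma bt_ind (Q : btens -> Prop) :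
  Q 0 -> (forall x y, Q x -> Q y -> Q (x + y)) -> (forall v w, Q (bt v w)) ->
  forall x, Q x.
Proof.
move=> Q0 QD Qb x; rewrite [x]bt_span.
by elim/big_ind: _ => // i _; elim/big_ind: _ => // j _; rewrite -btZl.
Qed.

Lemma blift_linear (T U : vectType C) (F : U -> M -> N -> T) x :
  (forall v w, linear (fun u => F u v w)) -> linear (fun u => blift (F u) x).
Proof.
move=> FL k u u'; rewrite /blift !comp_lfunE /vtens_lift.
have vl (f : M -> N -> T) : linear (fun A : vtens M N =>
    \sum_i \sum_j A i j *: f (vbasis {:M})`_i (vbasis {:N})`_j).
  move=> c A B; rewrite scaler_sumr -big_split; apply: eq_bigr => i _ /=.
  rewrite scaler_sumr -big_split; apply: eq_bigr => j _ /=.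
  by rewrite !mxE scalerDl scalerA.
rewrite !linfunE // scaler_sumr -big_split; apply: eq_bigr => i _ /=.
rewrite scaler_sumr -big_split; apply: eq_bigr => j _ /=.
by rewrite FL scalerDr !scalerA mulrC.
Qed.

Definition tproj g : 'End(btens) :=
  blift (fun v w => \sum_x bt (gcomp M x v) (gcomp N (x^-1 * g)%g w)).
Definition tlact h : 'End(btens) := blift (fun v w => bt (lact M h v) w).
Definition tract h : 'End(btens) := blift (fun v w => bt v (ract N h w)).

Lemma tprojE g v w :
  tproj g (bt v w) = \sum_x bt (gcomp M x v) (gcomp N (x^-1 * g)%g w).
Proof.
apply: bliftE => [|h {}v {}w].
  by apply: bilin_sum => x; apply: bilin_comp; exact: bt_bilin.
rewrite (reindex_inj (mulIg (sgval h))); apply: eq_bigr => x _ /=.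
rewrite gcomp_ract bt_bal -gcomp_lact; congr (bt _ (gcomp _ _ _)).
by rewrite invMg -mulgA mulKVg.
Qed.

Lemma tlactE h v w : tlact h (bt v w) = bt (lact M h v) w.
Proof.
apply: bliftE => [|k {}v {}w]; last by rewrite -lractC bt_bal.
split=> [{}v k x y|{}w k x y]; first exact: bt_bilin.1.
by rewrite linearP; exact: bt_bilin.2.
Qed.

Lemma tractE h v w : tract h (bt v w) = bt v (ract N h w).
Proof.
apply: bliftE => [|k {}v {}w]; last by rewrite bt_bal lractC.
split=> [{}v k x y|{}w k x y]; last exact: bt_bilin.2.
by rewrite linearP; exact: bt_bilin.1.
Qed.

Lemma tproj_sum x : \sum_g tproj g x = x.
Proof.
elim/bt_ind: x => [|x y IHx IHy|v w].
- by rewrite big1 // => g _; rewrite linear0.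
- by rewrite -[X in _ = X + _]IHx -[X in _ = _ + X]IHy -big_split;
    apply: eq_bigr => g _; rewrite linearD.
under eq_bigr do rewrite tprojE.
rewrite exchange_big /= -[X in bt X w](gcomp_sum v) bt_suml.
apply: eq_bigr => x _; rewrite -[X in bt _ X](gcomp_sum w) bt_sumr.
by rewrite [RHS](reindex_inj (mulgI (x^-1)%g)).
Qed.

Lemma tprojM g y x : tproj g (tproj y x) = if g == y then tproj y x else 0.
Proof.
elim/bt_ind: x => [|x z IHx IHz|v w].
- by rewrite !linear0 if_same.
- by rewrite !linearD /= IHx IHz; case: ifP => // _; rewrite addr0.
rewrite !tprojE linear_sum /=.
have -> : (if g == y then \sum_x bt (gcomp M x v) (gcomp N (x^-1 * y)%g w) else 0)
   = \sum_x (if g == y then bt (gcomp M x v) (gcomp N (x^-1 * y)%g w) else 0).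
  by case: ifP => // _; rewrite big1.
apply: eq_bigr => x _; rewrite tprojE (bigD1 x) //= big1 ?addr0.
  rewrite (gcompE _ (gcomp_in x v)) eqxx (gcompE _ (gcomp_in (x^-1 * y)%g w)).
  rewrite (inj_eq (mulgI _)); case: ifP => // _; exact: bt0r.
by move=> z zx; rewrite (gcompE _ (gcomp_in x v)) (negPf zx) bt0l.
Qed.

Lemma tlact1 x : tlact 1%g x = x.
Proof.
elim/bt_ind: x => [|x y IHx IHy|v w]; first by rewrite linear0.
  by rewrite linearD /= IHx IHy.
by rewrite tlactE lact1.
Qed.
Lemma tlactM h k x : tlact (h * k)%g x = tlact h (tlact k x).
Proof.
elim/bt_ind: x => [|x y IHx IHy|v w]; first by rewrite !linear0.
  by rewrite !linearD /= IHx IHy.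
by rewrite !tlactE lactM.
Qed.
Lemma tract1 x : tract 1%g x = x.
Proof.
elim/bt_ind: x => [|x y IHx IHy|v w]; first by rewrite linear0.
  by rewrite linearD /= IHx IHy.
by rewrite tractE ract1.
Qed.
Lemma tractM h k x : tract (h * k)%g x = tract k (tract h x).
Proof.
elim/bt_ind: x => [|x y IHx IHy|v w]; first by rewrite !linear0.
  by rewrite !linearD /= IHx IHy.
by rewrite !tractE ractM.
Qed.
Lemma tlractC h k x : tract k (tlact h x) = tlact h (tract k x).
Proof.
elim/bt_ind: x => [|x y IHx IHy|v w]; first by rewrite !linear0.
  by rewrite !linearD /= IHx IHy.
by rewrite tlactE !tractE tlactE.
Qed.
Lemma tproj_lact g h x : tproj (sgval h * g)%g (tlact h x) = tlact h (tproj g x).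
Proof.
elim/bt_ind: x => [|x y IHx IHy|v w]; first by rewrite !linear0.
  by rewrite !linearD /= IHx IHy.
rewrite tlactE !tprojE linear_sum (reindex_inj (mulgI (sgval h))).
apply: eq_bigr => x _; rewrite gcomp_lact -tlactE.
by rewrite invMg -mulgA mulKg.
Qed.
Lemma tproj_ract g h x : tproj (g * sgval h)%g (tract h x) = tract h (tproj g x).
Proof.
elim/bt_ind: x => [|x y IHx IHy|v w]; first by rewrite !linear0.
  by rewrite !linearD /= IHx IHy.
rewrite tractE !tprojE linear_sum.
by apply: eq_bigr => x _; rewrite mulgA gcomp_ract -tractE.
Qed.

Definition gtens : gbim :=
  mk_gbim tproj_sum tprojM tlact1 tlactM tract1 tractM tlractC
    tproj_lact tproj_ract.

Lemma bt_homog a b v w :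
  v \in homog M a -> w \in homog N b -> bt v w \in homog gtens (a * b)%g.
Proof.
move=> va wb; rewrite (gcomp_id (M := gtens)) mk_gcomp; apply/eqP; rewrite tprojE.
rewrite (bigD1 a) //= (gcompE _ va) eqxx mulKg (gcompE _ wb) eqxx.
rewrite big1 ?addr0 // => x xa; by rewrite (gcompE _ va) (negPf xa) bt0l.
Qed.

Lemma gtens_homog_ind g (T : vectType C) (f : 'Hom(btens, T)) (Q : {vspace T}) :
  (forall a b v w, v \in homog M a -> w \in homog N b -> (a * b)%g = g ->
     f (bt v w) \in Q) ->
  forall x : gtens, x \in homog gtens g -> f x \in Q.
Proof.
move=> fQ x; rewrite gcomp_id mk_gcomp => /eqP <-.
elim/bt_ind: x => [|x y IHx IHy|v w].
- by rewrite !linear0 mem0v.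
- by rewrite !linearD /= rpredD.
rewrite tprojE linear_sum rpred_sum // => x _.
by apply: fQ (gcomp_in _ _) (gcomp_in _ _) _; rewrite mulKVg.
Qed.
End Tensor.

Definition gdual_sort M : vectType C := 'Hom(M, C^o).

Section Dual.
Variable M : gbim.

Definition dcomp (a : 'End(M)) : 'End(gdual_sort M) :=
  linfun (fun phi : 'Hom(M, C^o) => (phi \o a)%VF).

Lemma dcompE a (phi : 'Hom(M, C^o)) v : dcomp a phi v = phi (a v).
Proof.
rewrite linfunE ?comp_lfunE // => k f g.
by rewrite comp_lfunDl -comp_lfunZl.
Qed.

Definition dproj g := dcomp (gcomp M g^-1%g).
Definition dlact h := dcomp (ract M h).
Definition dract h := dcomp (lact M h).

Lemma dproj_sum phi : \sum_g dproj g phi = phi.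
Proof.
apply/lfunP => v; rewrite sum_lfunE -[in RHS](gcomp_sum v) linear_sum.
rewrite [RHS](reindex_inj invg_inj); apply: eq_bigr => g _; exact: dcompE.
Qed.
Lemma dprojM g x phi : dproj g (dproj x phi) = if g == x then dproj x phi else 0.
Proof.
apply/lfunP => v; rewrite !dcompE (gcompE _ (gcomp_in g^-1%g v)).
rewrite (inj_eq invg_inj) eq_sym; case: eqVneq => [->|_]; last by rewrite linear0 zero_lfunE.
by rewrite dcompE.
Qed.
Lemma dlact1 phi : dlact 1%g phi = phi.
Proof. by apply/lfunP => v; rewrite dcompE ract1. Qed.
Lemma dlactM h k phi : dlact (h * k)%g phi = dlact h (dlact k phi).
Proof. by apply/lfunP => v; rewrite !dcompE ractM. Qed.
Lemma dract1 phi : dract 1%g phi = phi.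
Proof. by apply/lfunP => v; rewrite dcompE lact1. Qed.
Lemma dractM h k phi : dract (h * k)%g phi = dract k (dract h phi).
Proof. by apply/lfunP => v; rewrite !dcompE lactM. Qed.
Lemma dlractC h k phi : dract k (dlact h phi) = dlact h (dract k phi).
Proof. by apply/lfunP => v; rewrite !dcompE lractC. Qed.
Lemma dproj_lact g h phi : dproj (sgval h * g)%g (dlact h phi) = dlact h (dproj g phi).
Proof.
apply/lfunP => v; rewrite !dcompE -gcomp_ract invMg -mulgA.
by rewrite mulVg mulg1.
Qed.
Lemma dproj_ract g h phi : dproj (g * sgval h)%g (dract h phi) = dract h (dproj g phi).
Proof.
apply/lfunP => v; rewrite !dcompE -gcomp_lact invMg mulgA.
by rewrite mulgV mul1g.
Qed.

(* The dual has (h phi)(v) = phi (v h), (phi h)(v) = phi (h v), and |phi| = g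
   when phi vanishes on M_x for all x <> g^-1; see gdual_homog. *)
Definition gdual : gbim :=
  mk_gbim dproj_sum dprojM dlact1 dlactM dract1 dractM dlractC
    dproj_lact dproj_ract.

Lemma gdual_homog g (phi : gdual) :
  phi \in homog gdual g <->
  (forall x v, x != g^-1%g -> v \in homog M x -> (phi : 'Hom(M, C^o)) v = 0).
Proof.
rewrite gcomp_id mk_gcomp; split=> [/eqP <- x v xg vx|phi0].
  by rewrite dcompE (gcompE _ vx) eq_sym (negPf xg) linear0.
apply/eqP/lfunP => v; rewrite dcompE -[in RHS](gcomp_sum v) linear_sum.
rewrite (bigD1 g^-1%g) //= big1 ?addr0 // => x xg.
exact: phi0 xg (gcomp_in _ _).
Qed.
End Dual.
End Constructions.

Section StructureMaps.
Variables (C : fieldType) (gT : finGroupType) (H : {group gT}).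
Local Notation K := (subg_of H).
Local Notation gbim := (gbim C H).
Local Notation CH := {ffun K -> C^o}.
Implicit Types M N P U V W : gbim.

Definition gt M N (v : M) (w : N) : gtens M N := bt v w.
Local Notation "v ⊗ w" := (gt v w) (at level 40, left associativity).

Section GtTheory.
Variables M N : gbim.
Implicit Types (v : M) (w : N).
Lemma gt_bilin : bilin (@gt M N). Proof. exact: bt_bilin. Qed.
Lemma gtDl v v' w : (v + v') ⊗ w = v ⊗ w + v' ⊗ w. Proof. exact: btDl. Qed.
Lemma gtDr v w w' : v ⊗ (w + w') = v ⊗ w + v ⊗ w'. Proof. exact: btDr. Qed.
Lemma gt0l w : 0 ⊗ w = 0 :> gtens M N. Proof. exact: bt0l. Qed.
Lemma gt0r v : v ⊗ 0 = 0 :> gtens M N. Proof. exact: bt0r. Qed.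
Lemma gtZl a v w : (a *: v) ⊗ w = a *: (v ⊗ w). Proof. exact: btZl. Qed.
Lemma gtZr a v w : v ⊗ (a *: w) = a *: (v ⊗ w). Proof. exact: btZr. Qed.
Lemma gt_suml (I : Type) r (Q : pred I) (g : I -> M) w :
  (\sum_(i <- r | Q i) g i) ⊗ w = \sum_(i <- r | Q i) g i ⊗ w.
Proof. exact: bt_suml. Qed.
Lemma gt_sumr (I : Type) r (Q : pred I) (g : I -> N) v :
  v ⊗ (\sum_(i <- r | Q i) g i) = \sum_(i <- r | Q i) v ⊗ g i.
Proof. exact: bt_sumr. Qed.
Lemma gt_bal h v w : ract M h v ⊗ w = v ⊗ lact N h w.
Proof. exact: bt_bal. Qed.
Lemma gt_homog a b v w :
  v \in homog M a -> w \in homog N b -> v ⊗ w \in homog (gtens M N) (a * b)%g.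
Proof. exact: bt_homog. Qed.
End GtTheory.

Lemma lact_bt M N h (v : M) (w : N) : lact (gtens M N) h (v ⊗ w) = lact M h v ⊗ w.
Proof. exact: tlactE. Qed.
Lemma ract_bt M N h (v : M) (w : N) : ract (gtens M N) h (v ⊗ w) = v ⊗ ract N h w.
Proof. exact: tractE. Qed.

Lemma gtens_ind M N (Q : gtens M N -> Prop) :
  Q 0 -> (forall x y, Q x -> Q y -> Q (x + y)) -> (forall v w, Q (v ⊗ w)) ->
  forall x, Q x.
Proof. exact: bt_ind. Qed.

Lemma mor_tens M N P (f : 'Hom(gtens M N, P)) :
    (forall h v w, f (lact M h v ⊗ w) = lact P h (f (v ⊗ w))) ->
    (forall h v w, f (v ⊗ ract N h w) = ract P h (f (v ⊗ w))) ->
    (forall a b v w, v \in homog M a -> w \in homog N b ->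
       f (v ⊗ w) \in homog P (a * b)%g) ->
  is_mor f.
Proof.
move=> fl fr fh; split=> [h x|h x|g x].
- elim/gtens_ind: x => [|x y IHx IHy|v w]; first by rewrite !linear0.
    by rewrite !linearD /= IHx IHy.
  by rewrite lact_bt.
- elim/gtens_ind: x => [|x y IHx IHy|v w]; first by rewrite !linear0.
    by rewrite !linearD /= IHx IHy.
  by rewrite ract_bt.
by apply: gtens_homog_ind => a b v w va wb <-; apply: fh.
Qed.

Lemma ghom_tens_ext M N P (f g : ghom (gtens M N) P) :
  (forall v w, gfun f (v ⊗ w) = gfun g (v ⊗ w)) -> f = g.
Proof. by move=> fg; apply: ghomP; exact: bt_ext. Qed.

Section TensM.
Variables (M M' N N' : gbim) (f : ghom M M') (g : ghom N N').

Definition tensr : 'Hom(gtens M N, gtens M' N') :=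
  blift (fun v w => gfun f v ⊗ gfun g w).

Lemma tensrE v w : tensr (v ⊗ w) = gfun f v ⊗ gfun g w.
Proof.
have [_ fr _] := gfunP f; have [gl _ _] := gfunP g.
apply: bliftE => [|h {}v {}w]; first exact/bilin_comp/gt_bilin.
by rewrite fr gl gt_bal.
Qed.

Lemma tensr_mor : is_mor tensr.
Proof.
have [fl _ fh] := gfunP f; have [_ gr gh] := gfunP g.
apply: mor_tens => [h v w|h v w|a b v w va wb].
- by rewrite !tensrE fl lact_bt.
- by rewrite !tensrE gr ract_bt.
by rewrite tensrE gt_homog ?fh ?gh.
Qed.

Definition gtensm : ghom (gtens M N) (gtens M' N') := mk_mor tensr_mor.

Lemma gtensmE v w : gfun gtensm (v ⊗ w) = gfun f v ⊗ gfun g w.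
Proof. exact: tensrE. Qed.
End TensM.

Section Associator.
Variables U V W : gbim.

Definition ascr_aux (w : W) : 'Hom(gtens U V, gtens U (gtens V W)) :=
  blift (fun u v => u ⊗ (v ⊗ w)).
Definition ascr : 'Hom(gtens (gtens U V) W, gtens U (gtens V W)) :=
  blift (fun x w => ascr_aux w x).

Lemma ascr_auxE w u v : ascr_aux w (u ⊗ v) = u ⊗ (v ⊗ w).
Proof.
apply: bliftE => [|h {}u {}v]; last by rewrite gt_bal lact_bt.
split=> [{}u k x y|{}v k x y]; last by rewrite gtDl gtZl.
by rewrite gtDl gtZl gtDr gtZr.
Qed.

Lemma ascrE u v w : ascr (u ⊗ v ⊗ w) = u ⊗ (v ⊗ w).
Proof.
rewrite -ascr_auxE; apply: bliftE => [|h x {}w].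
  split=> [x|{}w]; last exact: linearP.
  apply: blift_linear => {}u {}v k y z.
  by rewrite !(gtDr, gtZr).
elim/gtens_ind: x => [|x y IHx IHy|{}u {}v]; first by rewrite !linear0.
  by rewrite !linearD /= IHx IHy.
by rewrite ract_bt !ascr_auxE gt_bal.
Qed.

Lemma ascr_mor : is_mor ascr.
Proof.
apply: mor_tens => [h x w|h x w|a b x w xa wb].
- elim/gtens_ind: x => [|x y IHx IHy|u v].
  + by rewrite !(linear0, gt0l).
  + by rewrite !(linearD, gtDl) /= IHx IHy.
  by rewrite lact_bt !ascrE lact_bt.
- elim/gtens_ind: x => [|x y IHx IHy|u v].
  + by rewrite !(linear0, gt0l).
  + by rewrite !(linearD, gtDl) /= IHx IHy.
  by rewrite !ascrE !ract_bt.
have btw_lin : linear (fun x : gtens U V => x ⊗ w).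
  by move=> k y z; rewrite gtDl gtZl.
pose f : 'Hom(gtens U V, gtens U (gtens V W)) :=
  (ascr \o linfun (fun x : gtens U V => x ⊗ w))%VF.
have fE y : f y = ascr (y ⊗ w) by rewrite comp_lfunE linfunE.
rewrite -fE; apply: (gtens_homog_ind _ xa) => a1 a2 u v ua va a12.
by rewrite fE ascrE -a12 -mulgA !gt_homog.
Qed.

Definition gasc : ghom (gtens (gtens U V) W) (gtens U (gtens V W)) :=
  mk_mor ascr_mor.

Lemma gascE u v w : gfun gasc (u ⊗ v ⊗ w) = u ⊗ (v ⊗ w).
Proof. exact: ascrE. Qed.

Definition ascr'_aux (u : U) : 'Hom(gtens V W, gtens (gtens U V) W) :=
  blift (fun v w => u ⊗ v ⊗ w).
Definition ascr' : 'Hom(gtens U (gtens V W), gtens (gtens U V) W) :=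
  blift (fun u y => ascr'_aux u y).

Lemma ascr'_auxE u v w : ascr'_aux u (v ⊗ w) = u ⊗ v ⊗ w.
Proof.
apply: bliftE => [|h {}v {}w]; last by rewrite -gt_bal ract_bt.
split=> [{}v k x y|{}w k x y]; first by rewrite gtDr gtZr.
by rewrite gtDr gtZr gtDl gtZl.
Qed.

Lemma ascr'E u v w : ascr' (u ⊗ (v ⊗ w)) = u ⊗ v ⊗ w.
Proof.
rewrite -ascr'_auxE; apply: bliftE => [|h {}u y].
  split=> [{}u|y]; first exact: linearP.
  apply: blift_linear => {}v {}w k x z.
  by rewrite !(gtDl, gtZl).
elim/gtens_ind: y => [|x y IHx IHy|{}v {}w]; first by rewrite !linear0.
  by rewrite !linearD /= IHx IHy.
by rewrite lact_bt !ascr'_auxE gt_bal.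
Qed.

Lemma ascr'_mor : is_mor ascr'.
Proof.
apply: mor_tens => [h u y|h u y|a b u y ua yb].
- elim/gtens_ind: y => [|x y IHx IHy|v w].
  + by rewrite !(linear0, gt0r).
  + by rewrite !(linearD, gtDr) /= IHx IHy.
  by rewrite !ascr'E !lact_bt.
- elim/gtens_ind: y => [|x y IHx IHy|v w].
  + by rewrite !(linear0, gt0r).
  + by rewrite !(linearD, gtDr) /= IHx IHy.
  by rewrite ract_bt !ascr'E ract_bt.
have btu_lin : linear (fun y : gtens V W => u ⊗ y).
  by move=> k x z; rewrite gtDr gtZr.
pose f : 'Hom(gtens V W, gtens (gtens U V) W) :=
  (ascr' \o linfun (fun y : gtens V W => u ⊗ y))%VF.
have fE x : f x = ascr' (u ⊗ x) by rewrite comp_lfunE linfunE.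
rewrite -fE; apply: (gtens_homog_ind _ yb) => b1 b2 v w vb wb b12.
by rewrite fE ascr'E -b12 mulgA !gt_homog.
Qed.

Definition gasc' : ghom (gtens U (gtens V W)) (gtens (gtens U V) W) :=
  mk_mor ascr'_mor.

Lemma gasc'E u v w : gfun gasc' (u ⊗ (v ⊗ w)) = u ⊗ v ⊗ w.
Proof. exact: ascr'E. Qed.
End Associator.

Definition uone : gunit C H := [ffun h : K => (h == 1%g)%:R] : CH.

Lemma uone_lact h : lact (gunit C H) h uone = ([ffun k : K => (k == h)%:R] : CH).
Proof.
apply/ffunP => k; rewrite ulactE !ffunE -(inj_eq (mulgI h)) mulKVg.
by rewrite mulg1.
Qed.
Lemma uone_ract h : ract (gunit C H) h uone = ([ffun k : K => (k == h)%:R] : CH).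
Proof.
apply/ffunP => k; rewrite uractE !ffunE -(inj_eq (mulIg h)) mulgKV.
by rewrite mul1g.
Qed.

Lemma uone_gen (a : gunit C H) : a = \sum_h (a : CH) h *: lact _ h uone.
Proof.
apply/ffunP => k; rewrite sum_ffunE (bigD1 k) //= uone_lact !ffunE eqxx.
rewrite big1 ?addr0 => [|h hk]; first exact/esym/mulr1.
by rewrite uone_lact !ffunE eq_sym (negPf hk); exact: mulr0.
Qed.

Lemma uone_homog : uone \in homog (gunit C H) 1%g.
Proof.
apply/gunit_homog => h h1; rewrite ffunE; case: eqVneq => // hE.
by rewrite hE eqxx in h1.
Qed.

Section Unitors.
Variable V : gbim.

Definition lunr : 'Hom(gtens (gunit C H) V, V) :=
  blift (fun (a : gunit C H) v => \sum_h (a : CH) h *: lact V h v).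

Lemma lunrE (a : gunit C H) v : lunr (a ⊗ v) = \sum_h (a : CH) h *: lact V h v.
Proof.
apply: bliftE => [|k {}a {}v].
  split=> [b k x y|x k b c]; rewrite scaler_sumr -big_split; apply: eq_bigr => h _.
    by rewrite linearP scalerDr !scalerA mulrC.
  by rewrite !ffunE scalerDl scalerA.
rewrite (reindex_inj (mulIg k)); apply: eq_bigr => h _ /=.
by rewrite lactM uractE mulgK.
Qed.

Lemma lunr_mor : is_mor lunr.
Proof.
apply: mor_tens => [h a v|h a v|x y a v ax vy].
- rewrite !lunrE linear_sum (reindex_inj (mulgI h)); apply: eq_bigr => k _ /=.
  by rewrite linearZ /= lactM ulactE mulKg.
- rewrite !lunrE linear_sum; apply: eq_bigr => k _.
  by rewrite linearZ /= lractC.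
rewrite lunrE rpred_sum // => k _; case: (eqVneq (sgval k) x) => [<-|kx].
  by rewrite memvZ // lact_homog.
by have /gunit_homog -> // := ax; rewrite scale0r mem0v.
Qed.

Definition glun : ghom (gtens (gunit C H) V) V := mk_mor lunr_mor.

Lemma glunE (a : gunit C H) v :
  gfun glun (a ⊗ v) = \sum_h (a : CH) h *: lact V h v.
Proof. exact: lunrE. Qed.

Definition lunr' : 'Hom(V, gtens (gunit C H) V) :=
  linfun (fun v => uone ⊗ v).

Lemma lunr'E v : lunr' v = uone ⊗ v.
Proof. by rewrite linfunE // => k x y; rewrite gtDr gtZr. Qed.

Lemma uone_bal h (v : V) : uone ⊗ lact V h v = lact _ h uone ⊗ v.
Proof. by rewrite -gt_bal uone_lact uone_ract. Qed.

Lemma lunr'_mor : is_mor lunr'.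
Proof.
split=> [h v|h v|g v vg]; rewrite !lunr'E.
- by rewrite uone_bal lact_bt.
- by rewrite ract_bt.
by rewrite -[g]mul1g gt_homog // uone_homog.
Qed.

Definition glun' : ghom V (gtens (gunit C H) V) := mk_mor lunr'_mor.

Lemma glun'E v : gfun glun' v = uone ⊗ v.
Proof. exact: lunr'E. Qed.

Definition runr : 'Hom(gtens V (gunit C H), V) :=
  blift (fun v (a : gunit C H) => \sum_h (a : CH) h *: ract V h v).

Lemma runrE (a : gunit C H) v : runr (v ⊗ a) = \sum_h (a : CH) h *: ract V h v.
Proof.
apply: bliftE => [|k {}v {}a].
  split=> [x k b c|b k x y]; rewrite scaler_sumr -big_split; apply: eq_bigr => h _.
    by rewrite !ffunE scalerDl scalerA.
  by rewrite linearP scalerDr !scalerA mulrC.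
rewrite [RHS](reindex_inj (mulgI k)); apply: eq_bigr => h _ /=.
by rewrite ractM ulactE mulKg.
Qed.

Lemma runr_mor : is_mor runr.
Proof.
apply: mor_tens => [h v a|h v a|x y v a vx ay].
- rewrite !runrE linear_sum; apply: eq_bigr => k _.
  by rewrite linearZ /= lractC.
- rewrite !runrE linear_sum (reindex_inj (mulIg h)); apply: eq_bigr => k _ /=.
  by rewrite linearZ /= ractM uractE mulgK.
rewrite runrE rpred_sum // => k _; case: (eqVneq (sgval k) y) => [<-|ky].
  by rewrite memvZ // ract_homog.
by have /gunit_homog -> // := ay; rewrite scale0r mem0v.
Qed.

Definition grun : ghom (gtens V (gunit C H)) V := mk_mor runr_mor.

Lemma grunE (a : gunit C H) v :
  gfun grun (v ⊗ a) = \sum_h (a : CH) h *: ract V h v.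
Proof. exact: runrE. Qed.

Definition runr' : 'Hom(V, gtens V (gunit C H)) :=
  linfun (fun v => v ⊗ uone).

Lemma runr'E v : runr' v = v ⊗ uone.
Proof. by rewrite linfunE // => k x y; rewrite gtDl gtZl. Qed.

Lemma runr'_mor : is_mor runr'.
Proof.
split=> [h v|h v|g v vg]; rewrite !runr'E.
- by rewrite lact_bt.
- by rewrite gt_bal uone_lact -uone_ract ract_bt.
by rewrite -[g]mulg1 gt_homog // uone_homog.
Qed.

Definition grun' : ghom V (gtens V (gunit C H)) := mk_mor runr'_mor.

Lemma grun'E v : gfun grun' v = v ⊗ uone.
Proof. exact: runr'E. Qed.

Lemma lun_uone v : gfun glun (uone ⊗ v) = v.
Proof.
rewrite glunE (bigD1 1%g) //= ffunE eqxx scale1r lact1 big1 ?addr0 //.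
by move=> h h1; rewrite ffunE (negPf h1) scale0r.
Qed.
Lemma run_uone v : gfun grun (v ⊗ uone) = v.
Proof.
rewrite grunE (bigD1 1%g) //= ffunE eqxx scale1r ract1 big1 ?addr0 //.
by move=> h h1; rewrite ffunE (negPf h1) scale0r.
Qed.
End Unitors.

Section Dual.
Variable V : gbim.

(* phi (x) v |-> \sum_h phi (v h^-1) h *)
Definition evr : 'Hom(gtens (gdual V) V, gunit C H) :=
  blift (fun (phi : gdual V) v =>
    [ffun h => (phi : 'Hom(V, C^o)) (ract V h^-1%g v)] : gunit C H).

Lemma dual_lactE h (phi : gdual V) v :
  (lact (gdual V) h phi : 'Hom(V, C^o)) v = (phi : 'Hom(V, C^o)) (ract V h v).
Proof. exact: dcompE. Qed.
Lemma dual_ractE h (phi : gdual V) v :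
  (ract (gdual V) h phi : 'Hom(V, C^o)) v = (phi : 'Hom(V, C^o)) (lact V h v).
Proof. exact: dcompE. Qed.

Lemma evrE (phi : gdual V) v h :
  (evr (phi ⊗ v) : CH) h = (phi : 'Hom(V, C^o)) (ract V h^-1%g v).
Proof.
rewrite bliftE ?ffunE // => [|k {}phi {}v].
  split=> [x k b c|b k x y]; apply/ffunP => k'; rewrite !ffunE ?linearP //.
  by rewrite add_lfunE scale_lfunE.
by apply/ffunP => k'; rewrite !ffunE dual_ractE lractC.
Qed.

Lemma evr_mor : is_mor evr.
Proof.
apply: mor_tens => [h phi v|h phi v|a b phi v pa vb].
- apply/ffunP => k; rewrite evrE dual_lactE ulactE evrE -ractM.
  by rewrite invMg invgK.
- by apply/ffunP => k; rewrite evrE uractE evrE -ractM invMg invgK.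
apply/gunit_homog => h hab; rewrite evrE.
apply: (iffLR (gdual_homog _ _) pa) (ract_homog h^-1%g vb).
apply: contraNneq hab => e; apply/eqP.
by rewrite -[X in _ = (X * _)%g]invgK -e invMg invgK mulgKV.
Qed.

Definition gev : ghom (gtens (gdual V) V) (gunit C H) := mk_mor evr_mor.

Lemma gevE (phi : gdual V) v h :
  (gfun gev (phi ⊗ v) : CH) h = (phi : 'Hom(V, C^o)) (ract V h^-1%g v).
Proof. exact: evrE. Qed.

Definition cobasis i : gdual V := linfun (coord (vbasis {:V}) i : V -> C^o).

Lemma cobasisE i v : (cobasis i : 'Hom(V, C^o)) v = coord (vbasis {:V}) i v.
Proof. by rewrite linfunE // => k x y; rewrite linearP. Qed.

(* \sum_i e_i (x) e^i *)
Definition casimir : gtens V (gdual V) := \sum_(i < \dim {:V}) (vbasis {:V})`_i ⊗ cobasis i.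

Lemma casimir_move (a b : 'End(V)) :
  \sum_(i < \dim {:V}) a (b (vbasis {:V})`_i) ⊗ cobasis i =
  \sum_(i < \dim {:V}) a (vbasis {:V})`_i ⊗ ((cobasis i \o b)%VF : gdual V).
Proof.
under eq_bigr => i _.
  rewrite (coord_vbasis (memvf (b (vbasis {:V})`_i))) linear_sum gt_suml.
  under eq_bigr do rewrite linearZ /= gtZl -gtZr.
  over.
rewrite exchange_big /=; apply: eq_bigr => j _; rewrite -gt_sumr.
congr (_ ⊗ _); apply/lfunP => v; rewrite sum_lfunE comp_lfunE cobasisE.
rewrite [in RHS](coord_vbasis (memvf v)) !linear_sum.
by apply: eq_bigr => i _; rewrite scale_lfunE cobasisE !linearZ /= mulrC.
Qed.

Lemma casimir_central h :
  lact (gtens V (gdual V)) h casimir = ract (gtens V (gdual V)) h casimir.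
Proof.
rewrite /casimir !linear_sum /=.
under eq_bigr do rewrite lact_bt.
under [RHS]eq_bigr do rewrite ract_bt.
transitivity (\sum_(i < \dim {:V}) \1%VF (lact V h (vbasis {:V})`_i) ⊗ cobasis i).
  by apply: eq_bigr => i _; rewrite id_lfunE.
rewrite casimir_move; apply: eq_bigr => i _; rewrite id_lfunE; congr (_ ⊗ _).
by apply/lfunP => v; rewrite dual_ractE comp_lfunE.
Qed.

Lemma casimir_homog : casimir \in homog (gtens V (gdual V)) 1%g.
Proof.
have casE : casimir = \sum_g \sum_(i < \dim {:V}) gcomp V g (vbasis {:V})`_i
                        ⊗ (cobasis i \o gcomp V g : gdual V)%VF.
  transitivity (\sum_g \sum_(i < \dim {:V}) gcomp V g (vbasis {:V})`_i ⊗ cobasis i).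
    rewrite exchange_big /=; apply: eq_bigr => i _.
    by rewrite -gt_suml gcomp_sum.
  apply: eq_bigr => g _.
  rewrite -casimir_move; apply: eq_bigr => i _.
  by rewrite (gcompE _ (gcomp_in _ _)) eqxx.
rewrite casE; apply: rpred_sum => g _; apply: rpred_sum => i _.
rewrite -[1%g](mulgV g) gt_homog ?gcomp_in //; apply/gdual_homog => x v xg vx.
by rewrite comp_lfunE (gcompE _ vx) eq_sym -[g]invgK (negPf xg) linear0.
Qed.
End Dual.
End StructureMaps.

Section Category.
Variables (C : numFieldType) (gT : finGroupType) (H : {group gT}).
Local Notation K := (subg_of H).
Local Notation gbim := (gbim C H).
Local Notation CH := {ffun K -> C^o}.
Local Notation "v ⊗ w" := (gt v w) (at level 40, left associativity).
Implicit Types U V W X : gbim.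

Section Coevaluation.
Variable V : gbim.

(* 1 |-> |H|^-1 \sum_i e_i (x) e^i *)
Definition dbr : 'Hom(gunit C H, gtens V (gdual V)) :=
  linfun (fun a : gunit C H =>
    #|K|%:R^-1 *: \sum_h (a : CH) h *: lact _ h (casimir V)).

Lemma dbrE (a : gunit C H) :
  dbr a = #|K|%:R^-1 *: \sum_h (a : CH) h *: lact _ h (casimir V).
Proof.
rewrite linfunE // => k x y; rewrite scalerA mulrC -scalerA -scalerDr.
congr (_ *: _); rewrite scaler_sumr -big_split; apply: eq_bigr => h _ /=.
by rewrite !ffunE scalerDl scalerA.
Qed.

Lemma dbr_mor : is_mor dbr.
Proof.
split=> [h a|h a|g a ag]; rewrite !dbrE.
- rewrite linearZ /=; congr (_ *: _).
  rewrite linear_sum (reindex_inj (mulgI h)).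
  by apply: eq_bigr => k _; rewrite linearZ /= lactM ulactE mulKg.
- rewrite linearZ /=; congr (_ *: _).
  rewrite linear_sum (reindex_inj (mulIg h)).
  apply: eq_bigr => k _; rewrite linearZ /= lactM uractE mulgK.
  by rewrite casimir_central lractC.
rewrite memvZ // rpred_sum // => k _; case: (eqVneq (sgval k) g) => [<-|kg].
  by rewrite memvZ // -[sgval k]mulg1 lact_homog // casimir_homog.
by have /gunit_homog -> // := ag; rewrite scale0r mem0v.
Qed.

Definition gdb : ghom (gunit C H) (gtens V (gdual V)) := mk_mor dbr_mor.

Lemma gdb_uone : gfun gdb (uone C H) = #|K|%:R^-1 *: casimir V.
Proof.
rewrite [LHS]dbrE (bigD1 1%g) //= ffunE eqxx scale1r lact1 big1 ?addr0 //.
by move=> h h1; rewrite ffunE (negPf h1) scale0r.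
Qed.
End Coevaluation.

Lemma card_K_neq0 : #|K|%:R != 0 :> C.
Proof. by rewrite pnatr_eq0 -lt0n; apply/card_gt0P; exists 1%g. Qed.

Definition gbimod_data : monData C := {|
  obj := gbim;
  mhom := @ghom C gT H;
  idm := @gid C gT H;
  cmp := @gcmp C gT H;
  munit := gunit C H;
  tens := @gtens C gT H;
  tensm := fun V V' W W' => @gtensm C gT H V V' W W';
  asc := @gasc C gT H;
  asc' := @gasc' C gT H;
  lun := @glun C gT H;
  lun' := @glun' C gT H;
  run := @grun C gT H;
  run' := @grun' C gT H;
  dual := @gdual C gT H;
  ev := @gev C gT H;
  db := gdb
|}.

Lemma gfun_linear V W v : linear (fun f : ghom V W => gfun f v).
Proof. by move=> k f g; rewrite /gfun linearP /= add_lfunE scale_lfunE. Qed.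

Lemma gcmp_bilin U V W : bilin (@gcmp C gT H U V W).
Proof.
split=> [g k x y|f k x y]; apply: ghomP => v; rewrite gfun_linear !gcmpE.
  by rewrite gfun_linear linearP.
by rewrite gfun_linear.
Qed.

Lemma gtensm_bilin V V' W W' : bilin (@gtensm C gT H V V' W W').
Proof.
split=> [f k x y|g k x y]; apply: ghom_tens_ext => v w;
  rewrite gfun_linear !gtensmE gfun_linear.
  by rewrite gtDr gtZr.
by rewrite gtDl gtZl.
Qed.

Lemma tens3_ind U V W (Q : gtens (gtens U V) W -> Prop) :
  Q 0 -> (forall x y, Q x -> Q y -> Q (x + y)) ->
  (forall u v w, Q (u ⊗ v ⊗ w)) -> forall x, Q x.
Proof.
move=> Q0 QD Qb; apply: gtens_ind => // x w.
elim/gtens_ind: x => [|x y IHx IHy|u v]; first by rewrite gt0l.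
  by rewrite gtDl; exact: QD.
exact: Qb.
Qed.

Lemma tens3'_ind U V W (Q : gtens U (gtens V W) -> Prop) :
  Q 0 -> (forall x y, Q x -> Q y -> Q (x + y)) ->
  (forall u v w, Q (u ⊗ (v ⊗ w))) -> forall x, Q x.
Proof.
move=> Q0 QD Qb; apply: gtens_ind => // u x.
elim/gtens_ind: x => [|x y IHx IHy|v w]; first by rewrite gt0r.
  by rewrite gtDr; exact: QD.
exact: Qb.
Qed.

Lemma ghom_tens3_ext U V W X (f g : ghom (gtens (gtens U V) W) X) :
  (forall u v w, gfun f (u ⊗ v ⊗ w) = gfun g (u ⊗ v ⊗ w)) -> f = g.
Proof.
move=> fg; apply: ghomP => x; elim/tens3_ind: x => [|x y IHx IHy|u v w].
- by rewrite !linear0.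
- by rewrite !linearD /= IHx IHy.
exact: fg.
Qed.

Lemma ghom_tens3'_ext U V W X (f g : ghom (gtens U (gtens V W)) X) :
  (forall u v w, gfun f (u ⊗ (v ⊗ w)) = gfun g (u ⊗ (v ⊗ w))) -> f = g.
Proof.
move=> fg; apply: ghomP => x; elim/tens3'_ind: x => [|x y IHx IHy|u v w].
- by rewrite !linear0.
- by rewrite !linearD /= IHx IHy.
exact: fg.
Qed.

Lemma gpentagon U V W X :
  gcmp (gasc U V (gtens W X)) (gasc (gtens U V) W X) =
  gcmp (gcmp (gtensm (gid U) (gasc V W X)) (gasc U (gtens V W) X))
       (gtensm (gasc U V W) (gid X)).
Proof.
apply: ghom_tens_ext => y x; elim/tens3_ind: y => [|y z IHy IHz|u v w].
- by rewrite gt0l !linear0.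
- by rewrite gtDl !linearD /= IHy IHz.
by rewrite !gcmpE !(gascE, gtensmE, gidE).
Qed.

Lemma gzigzag V :
  gcmp (gcmp (gcmp (gcmp (grun V) (gtensm (gid V) (gev V)))
    (gasc V (gdual V) V)) (gtensm (gdb V) (gid V))) (glun' V) = gid V.
Proof.
apply: ghomP => v; rewrite !gcmpE glun'E gtensmE !gidE gdb_uone.
rewrite gtZl /casimir gt_suml !linearZ /=.
transitivity (#|K|%:R^-1 *: \sum_(h : K) v); last first.
  by rewrite sumr_const -scaler_nat scalerA mulVf ?scale1r ?card_K_neq0.
congr (_ *: _); rewrite !linear_sum /=.
transitivity (\sum_(i < \dim {:V}) \sum_h
   coord (vbasis {:V}) i (ract V h^-1%g v) *: ract V h (vbasis {:V})`_i).
  apply: eq_bigr => i _; rewrite gascE gtensmE gidE grunE.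
  by apply: eq_bigr => h _; rewrite gevE cobasisE.
rewrite exchange_big /=; apply: eq_bigr => h _.
rewrite -[in RHS](ract1 v) -(mulVg h) ractM.
rewrite [in RHS](coord_vbasis (memvf (ract V h^-1%g v))) linear_sum.
by apply: eq_bigr => i _; rewrite linearZ.
Qed.

Lemma gzigzag_dual V :
  gcmp (gcmp (gcmp (gcmp (glun (gdual V)) (gtensm (gev V) (gid (gdual V))))
    (gasc' (gdual V) V (gdual V))) (gtensm (gid (gdual V)) (gdb V)))
    (grun' (gdual V)) = gid (gdual V).
Proof.
apply: ghomP => phi; rewrite !gcmpE grun'E gtensmE !gidE gdb_uone.
rewrite gtZr /casimir gt_sumr !linearZ /=.
transitivity (#|K|%:R^-1 *: \sum_(h : K) phi); last first.
  by rewrite sumr_const -scaler_nat scalerA mulVf ?scale1r ?card_K_neq0.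
congr (_ *: _); rewrite !linear_sum /=.
transitivity (\sum_(i < \dim {:V}) \sum_h
   (phi : 'Hom(V, C^o)) (ract V h^-1%g (vbasis {:V})`_i)
     *: lact (gdual V) h (cobasis i)).
  apply: eq_bigr => i _; rewrite gasc'E gtensmE gidE glunE.
  by apply: eq_bigr => h _; rewrite gevE.
rewrite exchange_big /=; apply: eq_bigr => h _.
apply/lfunP => v; rewrite sum_lfunE.
rewrite -[in RHS](ract1 v) -(mulgV h) ractM.
rewrite [in RHS](coord_vbasis (memvf (ract V h v))) !linear_sum.
apply: eq_bigr => i _; rewrite scale_lfunE dual_lactE cobasisE.
by rewrite !linearZ; exact: mulrC.
Qed.

Lemma gbimod_laws : rigidLaws gbimod_data.
Proof.
split.
- by move=> U V W X h g f; apply: ghomP => v; rewrite !gcmpE.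
- by move=> U V f; apply: ghomP => v; rewrite gcmpE gidE.
- by move=> U V f; apply: ghomP => v; rewrite gcmpE gidE.
- exact: gcmp_bilin.
- by move=> V W; apply: ghom_tens_ext => v w; rewrite gtensmE !gidE.
- move=> V V' V'' W W' W'' f' f g' g; apply: ghom_tens_ext => v w.
  by rewrite gcmpE !gtensmE !gcmpE.
- exact: gtensm_bilin.
- by move=> U V W; apply: ghom_tens3_ext => u v w; rewrite gcmpE gascE gasc'E gidE.
- by move=> U V W; apply: ghom_tens3'_ext => u v w; rewrite gcmpE gasc'E gascE gidE.
- move=> V; apply: ghom_tens_ext => a v; rewrite gcmpE glunE glun'E gidE.
  rewrite gt_sumr [in RHS](uone_gen a) gt_suml; apply: eq_bigr => h _.
  by rewrite gtZr gtZl uone_bal.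
- by move=> V; apply: ghomP => v; rewrite gcmpE glun'E lun_uone gidE.
- move=> V; apply: ghom_tens_ext => v a; rewrite gcmpE grunE grun'E gidE.
  rewrite gt_suml [in RHS](uone_gen a) gt_sumr; apply: eq_bigr => h _.
  by rewrite gtZr gtZl gt_bal.
- by move=> V; apply: ghomP => v; rewrite gcmpE grun'E run_uone gidE.
- move=> U U' V V' W W' f g h; apply: ghom_tens3_ext => u v w.
  by rewrite !gcmpE !(gascE, gtensmE).
- move=> V V' f; apply: ghom_tens_ext => a v; rewrite !gcmpE gtensmE gidE !glunE.
  have [fl _ _] := gfunP f; rewrite linear_sum; apply: eq_bigr => h _.
  by rewrite linearZ /= fl.
- move=> V V' f; apply: ghom_tens_ext => v a; rewrite !gcmpE gtensmE gidE !grunE.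
  have [_ fr _] := gfunP f; rewrite linear_sum; apply: eq_bigr => h _.
  by rewrite linearZ /= fr.
- exact: gpentagon.
- move=> V W; apply: ghom_tens3_ext => v a w.
  rewrite gcmpE gascE !gtensmE !gidE glunE grunE gt_sumr gt_suml.
  by apply: eq_bigr => h _; rewrite gtZr gtZl gt_bal.
- exact: gzigzag.
- exact: gzigzag_dual.
Qed.

Definition gbimod : rigidCat C := RigidCat gbimod_laws.
End Category.

Section StandardPivotal.
Variables (C : numFieldType) (gT : finGroupType) (H : {group gT}).
Local Notation K := (subg_of H).
Local Notation gbim := (gbim C H).
Local Notation D := (gbimod C H).
Local Notation CH := {ffun K -> C^o}.
Local Notation "v ⊗ w" := (gt v w) (at level 40, left associativity).
Implicit Types V W : gbim.

Local Notation app phi v := ((phi : 'Hom(_, C^o)) v).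

Lemma cat_cmpE (U V W : D) (g : mhom V W) (f : mhom U V) v :
  gfun (g ∘ f : ghom _ _)%mon v = gfun (g : ghom _ _) (gfun (f : ghom _ _) v).
Proof. exact: gcmpE. Qed.
Lemma cat_idE (V : D) v : gfun (idm V : ghom _ _) v = v.
Proof. exact: gidE. Qed.
Lemma cat_tensmE (V V' W W' : D) (f : mhom V V') (g : mhom W W') v w :
  gfun (f ⊠ g : ghom _ _)%mon (v ⊗ w) =
  gfun (f : ghom _ _) v ⊗ gfun (g : ghom _ _) w.
Proof. exact: gtensmE. Qed.
Lemma cat_ascE (U V W : D) u v w :
  gfun (asc U V W : ghom _ _) (u ⊗ v ⊗ w) = u ⊗ (v ⊗ w).
Proof. exact: gascE. Qed.
Lemma cat_asc'E (U V W : D) u v w :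
  gfun (asc' U V W : ghom _ _) (u ⊗ (v ⊗ w)) = u ⊗ v ⊗ w.
Proof. exact: gasc'E. Qed.
Lemma cat_lunE (V : D) (a : gunit C H) v :
  gfun (lun V : ghom _ _) (a ⊗ v) = \sum_h (a : CH) h *: lact V h v.
Proof. exact: glunE. Qed.
Lemma cat_lun'E (V : D) v : gfun (lun' V : ghom _ _) v = uone C H ⊗ v.
Proof. exact: glun'E. Qed.
Lemma cat_runE (V : D) (a : gunit C H) v :
  gfun (run V : ghom _ _) (v ⊗ a) = \sum_h (a : CH) h *: ract V h v.
Proof. exact: grunE. Qed.
Lemma cat_run'E (V : D) v : gfun (run' V : ghom _ _) v = v ⊗ uone C H.
Proof. exact: grun'E. Qed.
Lemma cat_evE (V : D) (phi : gdual V) v h :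
  (gfun (ev V : ghom _ _) (phi ⊗ v) : CH) h = app phi (ract V h^-1%g v).
Proof. exact: gevE. Qed.
Lemma cat_dbE (V : D) :
  gfun (db V : ghom _ _) (uone C H) = #|K|%:R^-1 *: casimir V.
Proof. exact: gdb_uone. Qed.

Definition catE := (cat_cmpE, cat_idE, cat_tensmE, cat_ascE, cat_asc'E,
  cat_lunE, cat_lun'E, cat_runE, cat_run'E).

Lemma dualmE V W (f : ghom V W) (phi : gdual W) :
  gfun (@dualm C D V W f) phi = ((phi : 'Hom(W, C^o)) \o gfun f)%VF.
Proof.
rewrite /dualm !catE cat_dbE.
rewrite linearZ /= gtZr !linearZ /= /casimir linear_sum gt_sumr.
transitivity (#|K|%:R^-1 *: \sum_(h : K) ((phi : 'Hom(W, C^o)) \o gfun f)%VF); last first.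
  by rewrite sumr_const -scaler_nat scalerA mulVf ?scale1r ?card_K_neq0.
congr (_ *: _); rewrite !linear_sum /=.
transitivity (\sum_(i < \dim {:V}) \sum_h
   app phi (ract W h^-1%g (gfun f (vbasis {:V})`_i))
     *: lact (gdual V) h (cobasis i)).
  apply: eq_bigr => i _; rewrite !catE.
  by apply: eq_bigr => h _; rewrite cat_evE.
have [_ fr _] := gfunP f.
rewrite exchange_big /=; apply: eq_bigr => h _.
apply/lfunP => v; rewrite sum_lfunE comp_lfunE.
rewrite -[in RHS](ract1 v) -(mulgV h) ractM.
rewrite [in RHS](coord_vbasis (memvf (ract V h v))) !linear_sum.
apply: eq_bigr => i _; rewrite scale_lfunE dual_lactE cobasisE -fr.
by rewrite !linearZ; exact: mulrC.
Qed.

Lemma dual_tensE V W (c : ghom (gtens (gdual W) (gdual V)) (gdual (gtens V W))) :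
  @is_dual_tens C D V W c -> forall (psi : gdual W) (phi : gdual V) v w,
  app (gfun c (psi ⊗ phi)) (v ⊗ w) =
  \sum_h app phi (ract V h^-1%g v) * app psi (lact W h w).
Proof.
move=> cP psi phi v w.
have := congr1 (fun f : ghom _ _ => gfun f (psi ⊗ phi ⊗ (v ⊗ w))) cP.
rewrite !catE.
move/(congr1 (fun a : gunit C H => (a : CH) 1%g)).
rewrite !cat_evE invg1 !ract1 => ->.
rewrite linear_sum; apply: eq_bigr => h _.
by rewrite linearZ /= cat_evE.
Qed.

Section Map.
Variable V : gbim.

Definition spivr : 'Hom(V, gdual (gdual V)) :=
  linfun (fun v => linfun (fun phi : gdual V => (app phi v : C^o)) : gdual (gdual V)).

Lemma spivrE v (phi : gdual V) : app (spivr v) phi = app phi v.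
Proof.
have L u : linear (fun phi : gdual V => (app phi u : C^o)).
  by move=> k x y; rewrite add_lfunE scale_lfunE.
rewrite /spivr linfunE; first by rewrite linfunE.
move=> k x y; apply/lfunP => psi.
by rewrite add_lfunE scale_lfunE !linfunE // linearP.
Qed.

Lemma spivr_mor : is_mor spivr.
Proof.
split=> [h v|h v|g v vg].
- by apply/lfunP => phi; rewrite spivrE dual_lactE spivrE dual_ractE.
- by apply/lfunP => phi; rewrite spivrE dual_ractE spivrE dual_lactE.
apply/gdual_homog => x phi xg /gdual_homog phix; rewrite spivrE.
by apply: phix vg; apply: contraNneq xg => ->; rewrite invgK.
Qed.

Definition spiv : ghom V (gdual (gdual V)) := mk_mor spivr_mor.

Lemma spivE v (phi : gdual V) : app (gfun spiv v) phi = app phi v.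
Proof. exact: spivrE. Qed.

Definition spivr' : 'Hom(gdual (gdual V), V) :=
  linfun (fun x : gdual (gdual V) =>
    \sum_(i < \dim {:V}) app x (cobasis i) *: (vbasis {:V})`_i).

Lemma spivr'E (x : gdual (gdual V)) :
  spivr' x = \sum_(i < \dim {:V}) app x (cobasis i) *: (vbasis {:V})`_i.
Proof.
rewrite linfunE // => k y z; rewrite scaler_sumr -big_split.
by apply: eq_bigr => i _; rewrite /= add_lfunE scale_lfunE scalerDl scalerA.
Qed.

Lemma spivr'K v : spivr' (spivr v) = v.
Proof.
rewrite spivr'E [RHS](coord_vbasis (memvf v)).
by apply: eq_bigr => i _; rewrite spivrE cobasisE.
Qed.

Lemma spivrK x : spivr (spivr' x) = x.
Proof.
apply/lfunP => phi; rewrite spivrE spivr'E linear_sum.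
transitivity (app x (\sum_(i < \dim {:V}) app phi (vbasis {:V})`_i *: cobasis i)).
  rewrite linear_sum; apply: eq_bigr => i _; rewrite !linearZ; exact: mulrC.
congr (fun_of_lfun _ _); apply/lfunP => v; rewrite sum_lfunE.
rewrite [in RHS](coord_vbasis (memvf v)) linear_sum; apply: eq_bigr => i _.
rewrite scale_lfunE cobasisE linearZ; exact: mulrC.
Qed.

Lemma spivr'_mor : is_mor spivr'.
Proof.
have [fl fr fh] := spivr_mor.
have inj : injective spivr by exact: can_inj spivr'K.
split=> [h x|h x|g x xg].
- by apply: inj; rewrite fl !spivrK.
- by apply: inj; rewrite fr !spivrK.
move: xg; rewrite !gcomp_id => /eqP xg; apply/eqP/inj; rewrite spivrK -[RHS]xg.
apply/esym; apply: (gcomp_unique (u := fun y => spivr (gcomp V y (spivr' x)))).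
  by move=> y; apply/fh/gcomp_in.
by rewrite -linear_sum gcomp_sum /= spivrK.
Qed.

Definition spiv' : ghom (gdual (gdual V)) V := mk_mor spivr'_mor.
End Map.

Lemma spivK V : gcmp (spiv' V) (spiv V) = gid V.
Proof. by apply: ghomP => v; rewrite gcmpE gidE; exact: spivr'K. Qed.
Lemma spiv'K V : gcmp (spiv V) (spiv' V) = gid (gdual (gdual V)).
Proof. by apply: ghomP => v; rewrite gcmpE gidE; exact: spivrK. Qed.

Lemma spiv_nat V W (f : ghom V W) :
  gcmp (spiv W) f = gcmp (@dualm C D _ _ (@dualm C D _ _ f)) (spiv V).
Proof.
apply: ghomP => v; rewrite [LHS]gcmpE [RHS]gcmpE; apply/lfunP => phi.
rewrite (dualmE (dualm (f : @mhom C D V W) : ghom (gdual W) (gdual V))).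
by rewrite comp_lfunE dualmE !spivE comp_lfunE.
Qed.

Lemma spiv_tens V W (c : ghom (gtens (gdual W) (gdual V)) (gdual (gtens V W)))
    (c' : ghom (gtens (gdual (gdual V)) (gdual (gdual W)))
               (gdual (gtens (gdual W) (gdual V)))) :
  @is_dual_tens C D _ _ c -> @is_dual_tens C D _ _ c' ->
  gcmp (@dualm C D _ _ c) (spiv (gtens V W)) = gcmp c' (gtensm (spiv V) (spiv W)).
Proof.
move=> cP c'P; apply: ghom_tens_ext => v w; rewrite [LHS]gcmpE [RHS]gcmpE gtensmE.
rewrite dualmE; apply/lfunP => y; rewrite comp_lfunE.
elim/gtens_ind: y => [|x y IHx IHy|psi phi]; first by rewrite !linear0.
  by rewrite !linearD /= IHx IHy.
rewrite (dual_tensE c'P) spivE (dual_tensE cP) (reindex_inj invg_inj).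
by apply: eq_bigr => h _ /=; rewrite invgK !spivE dual_ractE dual_lactE mulrC.
Qed.

(* V -> V^vv, v |-> (phi |-> phi v): a pivotal structure, whose dimensions are
   dim V / |H|. *)
Definition std_pivotal : pivotal D :=
  @Pivotal C D spiv spiv' spivK spiv'K spiv_nat spiv_tens.

Lemma gunitZE k (a : gunit C H) h : ((k *: a : gunit C H) : CH) h = k * (a : CH) h.
Proof. by rewrite ffunE. Qed.

Lemma gunit_sumE (I : finType) (a : I -> gunit C H) h :
  ((\sum_i a i : gunit C H) : CH) h = \sum_i (a i : CH) h.
Proof. exact: sum_ffunE. Qed.

Lemma gfunZE V W k (f : ghom V W) v : gfun (k *: f) v = k *: gfun f v.
Proof. by rewrite /gfun linearZ scale_lfunE. Qed.

Lemma std_pivdim V : is_pivdim std_pivotal V ((\dim {:V})%:R / #|K|%:R).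
Proof.
rewrite /is_pivdim; set f := (X in X = _); pose f0 : ghom (gunit C H) (gunit C H) := f.
have fE h : (gfun f0 (uone C H) : CH) h =
    #|K|%:R^-1 * \sum_(i < \dim {:V}) coord (vbasis {:V}) i (lact V h^-1%g (vbasis {:V})`_i).
  rewrite /f0 /f !cat_cmpE cat_dbE !linearZ /= /casimir.
  apply: etrans (gunitZE _ _ _) _; congr (_ * _); rewrite !linear_sum /=.
  apply: etrans (gunit_sumE _ _) _; apply: eq_bigr => i _.
  by rewrite !catE cat_evE spivE dual_ractE cobasisE.
have f1 : gfun f0 (uone C H) = ((\dim {:V})%:R / #|K|%:R) *: uone C H.
  apply/ffunP => h; rewrite !ffunE; case: eqVneq => [->|h1].
    rewrite fE invg1 [RHS]mulr1 mulrC; congr (_ * _).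
    under eq_bigr do rewrite lact1 coord_free ?(basis_free (vbasisP _)) // eqxx.
    by rewrite sumr_const card_ord.
  have [_ _ fh] := gfunP f0; have /fh/gunit_homog -> := uone_homog C H.
    by rewrite [RHS]mulr0.
  by apply: contraNneq h1 => h1; apply/eqP/val_inj.
apply: ghomP => a; rewrite [in LHS](uone_gen a) [in RHS](uone_gen a) !linear_sum.
apply: eq_bigr => h _; rewrite !linearZ; congr (_ *: _).
have [fl _ _] := gfunP f0; rewrite [LHS]fl f1.
rewrite linearZ; apply: esym; apply: etrans (gfunZE _ _ _) _.
by congr (_ *: _); exact: gidE.
Qed.
End StandardPivotal.

Section InducedObject.
Variables (C : fieldType) (gT : finGroupType) (H : {group gT}).
Implicit Types (M : gbim C H) (d : gT).

Definition coset_stab d : {group gT} := (H :&: H :^ d^-1)%G.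

Lemma coset_stabP d h :
  h \in coset_stab d = (h \in H) && ((h *: (d *: H))%g == (d *: H)%g).
Proof.
rewrite inE mem_conjgV conjgE -lcosetM; congr (_ && _).
by rewrite -mem_lcoset; apply/idP/eqP => /lcoset_eqP.
Qed.

Definition coset_part d M : {vspace M} := (\sum_(g in (d *: H)%g) homog M g)%VS.

(* The span of all mk - m, with m in M_{dH} and k in H. *)
Definition coset_rel d M : {vspace M} :=
  (\sum_k (ract M k - \1)%VF @: coset_part d M)%VS.

(* M is a value at W of the equivalence inverse to M |-> (M_{dH})/H, that is,
   M has all its degrees in HdH and (M_{dH})/H, the image of M_{dH} in
   M / coset_rel d M, is isomorphic to W as a representation of S.  The matrices
   W s act on column vectors, which makes W a left representation. *)
Definition is_Fd d n (W : mx_representation C (coset_stab d) n) M : Prop :=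
  (forall g, g \notin (H :* d * H)%g -> homog M g = 0%VS) /\
  exists phi : 'Hom(quot (coset_rel d M), 'cV[C]_n),
    let Q := (quo (coset_rel d M) @: coset_part d M)%VS in
    [/\ (phi @: Q = fullv)%VS, (Q :&: lker phi = 0)%VS
      & forall s m, s \in coset_stab d -> m \in coset_part d M ->
          phi (quo _ (lact M (subg H s) m)) = W s *m phi (quo _ m)].

End InducedObject.

(* Main.v *)
Require Import Defs.
From mathcomp Require Import all_boot all_order all_fingroup all_algebra.
From mathcomp Require Import mxrepresentation complex reals.
From Stdlib Require Import Classical.

Set Implicit Arguments.
Unset Strict Implicit.
Unset Printing Implicit Defensive.

Import Defs GroupScope Order.TTheory GRing.Theory Num.Theory.
Import passmx.
Local Open Scope ring_scope.

(** Two questions are answered separately: which pivotal structure is canonical,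
    and what the trace of the rotation is.

    The canonical structure is the map V -> V^vv, v |-> (phi |-> phi v).  Another
    pivotal structure differs from it by an automorphism of the identity functor.
    On a simple object V this is a scalar (Schur, [simple_endo]), namely the ratio
    of the pivotal dimension of V to dim V / |H|.  But dim V / |H| is the
    Frobenius-Perron dimension of V ([FPdimE]), because the dimensions of the
    simple objects form a positive eigenvector of the fusion matrix
    ([perron_eigenvalue]).  So the scalar is 1 on simple objects, and, since every
    object is a sum of simple ones ([gbim_ind]), the two structures agree
    ([canonical_pivotalE]).

    For the trace, a morphism CH -> X is an element of degree 1 of X that commutes
    with H, and a trace on Hom(CH, X) becomes a trace on X after composition with
    the averaging projection ([ltrace_unit_hom]).  In these terms the rotation of
    V (x) T, with T a power of V, is v (x) y |-> 1/|H| sum_h h y (x) v h^-1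
    ([FS_map_uone]).  A trace on V (x) T is a sum of traces on T, one for each
    vector of a basis of V ([ltrace_gtens]), so the factors of the tensor power can
    be traced out one by one ([ltrace_rot_map]); the grading selects one term for
    each element of H at every stage.  The outcome is
      nu_m(V) = 1/|H| sum_(z in G, z^m in H) Tr (v |-> z^-m v z^m on V_z)
    ([FS_indicatorE]).

    For V = F_d(W) the summand vanishes off HdH and depends only on the class of z
    under conjugation by H, and exactly |S| elements k of H satisfy k^-1 z k in dH
    when z is in HdH; hence the sum may be taken over r in dH with 1/|S| in front
    ([sum_class_coset]).  Finally V_r is isomorphic to (V_dH)/H = W, the right
    action becoming trivial, so that the trace is eta(r^-m) ([conj_trace_Fd]), the
    complex conjugate of eta(r^m) ([repr_trace_conj]). *)

(** * Traces, positive matrices and characters *)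

Section Trace.
Variable C : fieldType.

Lemma ltrace_cycle (U V : vectType C) (a : U -> V) (b : V -> U) :
  linear a -> linear b -> ltrace (b \o a) = ltrace (a \o b).
Proof.
move=> aL bL.
pose A : 'Hom(U, V) := linfun a; pose B : 'Hom(V, U) := linfun b.
have aE u : a u = A u by rewrite linfunE.
have bE v : b v = B v by rewrite linfunE.
rewrite /ltrace.
transitivity (\sum_(i < \dim {:U}) \sum_(j < \dim {:V}) coord (vbasis {:V}) j (A (vbasis {:U})`_i) *
    coord (vbasis {:U}) i (B (vbasis {:V})`_j)).
  apply: eq_bigr => i _; rewrite /= aE bE.
  rewrite {1}(coord_vbasis (memvf (A (vbasis {:U})`_i))) !linear_sum /=.
  by apply: eq_bigr => j _; rewrite !linearZ.
rewrite exchange_big /=; apply: eq_bigr => j _; rewrite aE bE.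
rewrite [in RHS](coord_vbasis (memvf (B (vbasis {:V})`_j))) !linear_sum /=.
by apply: eq_bigr => i _; rewrite !linearZ /= mulrC.
Qed.

Lemma eq_ltrace (U : vectType C) (f g : U -> U) :
  f =1 g -> ltrace f = ltrace g.
Proof. by move=> fg; apply: eq_bigr => i _; rewrite fg. Qed.

(** A spanning family u with coordinate forms c, possibly redundant, computes the
    trace just as a basis does: the family factors the identity of U through the
    free space on I.  Tensor products over a group algebra come with such a
    redundant family but with no convenient basis. *)
Lemma ltrace_frame (U : vectType C) (I : finType) (u : I -> U)
    (c : I -> 'Hom(U, C^o)) (f : U -> U) :
  linear f -> (forall x, x = \sum_i (c i x : C) *: u i) ->
  ltrace f = \sum_i (c i (f (u i)) : C).
Proof.
move=> fL cu; pose F : 'Hom(U, U) := linfun f.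
have fE x : f x = F x by rewrite linfunE.
transitivity (\sum_(k < \dim {:U}) \sum_i (c i (F (vbasis {:U})`_k) : C) * coord (vbasis {:U}) k (u i)).
  apply: eq_bigr => k _; rewrite fE {1}[F _]cu linear_sum.
  by apply: eq_bigr => i _; rewrite linearZ.
rewrite exchange_big; apply: eq_bigr => i _ /=.
rewrite fE {2}(coord_vbasis (memvf (u i))) !linear_sum.
by apply: eq_bigr => k _; rewrite !linearZ /= mulrC.
Qed.

Lemma ltrace_id (U : vectType C) : ltrace (fun x : U => x) = (\dim {:U})%:R.
Proof.
rewrite /ltrace; under eq_bigr do rewrite coord_free ?(basis_free (vbasisP _)) // eqxx.
by rewrite sumr_const card_ord.
Qed.

Lemma ltraceD (U : vectType C) (f g : U -> U) :
  ltrace (fun x => f x + g x) = ltrace f + ltrace g.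
Proof. by rewrite -big_split; apply: eq_bigr => i _; rewrite linearD. Qed.

Lemma ltraceZ (U : vectType C) a (f : U -> U) :
  ltrace (fun x => a *: f x) = a * ltrace f.
Proof. by rewrite mulr_sumr; apply: eq_bigr => i _; rewrite linearZ. Qed.

Lemma ltrace_sum (U : vectType C) (I : finType) (P : pred I) (f : I -> U -> U) :
  ltrace (fun x => \sum_(i | P i) f i x) = \sum_(i | P i) ltrace (f i).
Proof.
by rewrite exchange_big; apply: eq_bigr => k _ /=; rewrite linear_sum.
Qed.

Lemma ltrace_mx n (A : 'M[C]_n) : ltrace (fun x : 'cV[C]_n => A *m x) = \tr A.
Proof.
have L (i : 'I_n) : linear (fun x : 'cV[C]_n => x i 0 : C^o).
  by move=> k x y; rewrite !mxE.
rewrite (@ltrace_frame _ 'I_n (fun i => delta_mx i 0)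
  (fun i => linfun (fun x : 'cV[C]_n => x i 0 : C^o))).
- by apply: eq_bigr => i _; rewrite linfunE // -colE mxE.
- by move=> k x y; rewrite mulmxDr scalemxAr.
move=> x; rewrite [LHS]matrix_sum_delta; apply: eq_bigr => i _.
by rewrite big_ord1 linfunE.
Qed.

End Trace.

Lemma endo_eigenvector (C : closedFieldType) (V : vectType C) (f : 'End(V)) :
  \dim {:V} != 0%N -> exists a, exists2 v, v != 0 & f v = a *: v.
Proof.
move=> dV; pose e := vbasis {:V}.
have eb : basis_of {:V} e := vbasisP _.
pose A := mxof e e f.
have [a Aa] : exists a, eigenvalue A a.
  have [|a] := closed_rootP (char_poly A) _; last by rewrite -eigenvalue_root_char; exists a.
  by rewrite size_char_poly eqSS.
exists a; have /eigenvalueP[w wA w0] := Aa; exists (vecof e w).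
  apply: contraNneq w0 => w0; rewrite -(vecofK eb w) w0.
  by rewrite linear0.
by rewrite (hom_vecof e eb) wA linearZ.
Qed.

(** Pairing an eigenvector w, with eigenvalue b, against the positive left
    eigenvector v gives b * (v . |w|) <= v . (N |w|) = a * (v . |w|), and v . |w|
    is positive.  As [eigenvalue] speaks of left eigenvectors, w is taken for
    the transpose of N, which has the same characteristic polynomial. *)
Lemma perron_eigenvalue (C : numFieldType) n (N : 'M[C]_n) (v : 'I_n -> C) (a : C) :
  (0 < n)%N -> (forall i k, 0 <= N i k) -> (forall i, 0 < v i) ->
  (forall k, \sum_i v i * N i k = a * v k) ->
  eigenvalue N a /\ (forall b, 0 <= b -> eigenvalue N b -> b <= a).
Proof.
move=> n0 N0 v0 vN; split.
  apply/eigenvalueP; exists (\row_i v i).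
    apply/rowP => k; rewrite !mxE -vN; apply: eq_bigr => i _; by rewrite mxE.
  case: n n0 N v N0 v0 vN => // n _ N v _ v0 _.
  by apply/rowV0Pn; exists (\row_i v i) => //; apply/eqP => /rowP/(_ ord0)/eqP;
    rewrite !mxE gt_eqF.
move=> b b0.
have -> : eigenvalue N b = eigenvalue N^T b.
  rewrite !eigenvalue_root_char /char_poly -[in RHS]det_tr.
  congr (root (\det _) b); apply/matrixP => i k.
  by rewrite !mxE eq_sym.
case/eigenvalueP => w wN w0.
have wE i : b * w 0 i = \sum_k N i k * w 0 k.
  have /rowP/(_ i) := wN; rewrite !mxE => <-.
  by apply: eq_bigr => k _; rewrite mxE mulrC.
pose s := \sum_k v k * `|w 0 k|.
have s0 : 0 < s.
  have [i wi] : exists i, w 0 i != 0.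
    by apply/existsP; apply: contraNT w0 => /existsPn w0; apply/eqP/rowP => i;
      rewrite mxE; apply/eqP; rewrite -[_ == _]negbK.
  rewrite /s (bigD1 i) //= ltr_wpDr ?mulr_gt0 ?normr_gt0 //.
  by apply: sumr_ge0 => k _; rewrite mulr_ge0 // ltW.
rewrite -(ler_pM2r s0) /s !mulr_sumr.
under [leRHS]eq_bigr do rewrite mulrA -vN mulr_suml.
rewrite exchange_big /=; apply: ler_sum => i _.
rewrite mulrCA -[b]ger0_norm // -normrM wE -[v i in leLHS]gtr0_norm //.
rewrite -normrM mulr_sumr; apply: le_trans (ler_norm_sum _ _ _) _.
by apply: ler_sum => k _; rewrite !normrM gtr0_norm // ger0_norm ?mulrA.
Qed.

(** The averaged form B is positive definite and invariant under W, so that W x^-1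
    is conjugate by B to the conjugate transpose of W x. *)
Lemma repr_trace_conj (C : numClosedFieldType) (gT : finGroupType)
    (G : {group gT}) n (W : mx_representation C G n) x :
  x \in G -> \tr (W x^-1%g) = (\tr (W x))^*.
Proof.
move=> Gx.
(* The form x |-> sum_s ||x W s||^2, written as a matrix. *)
pose B := \sum_(s in G) W s *m (map_mx Num.conj (W s))^T.
have BW : W x *m B *m (map_mx Num.conj (W x))^T = B.
  rewrite /B mulmx_sumr mulmx_suml [RHS](reindex_inj (mulgI x)) /=.
  rewrite [RHS](eq_bigl (fun s => s \in G)) => [|s]; last by rewrite groupMl.
  apply: eq_bigr => s Gs; rewrite repr_mxM // map_mxM trmx_mul.
  by rewrite !mulmxA.
have Bu : B \in unitmx.
  rewrite -row_free_unit -kermx_eq0; apply/rowV0P => u /sub_kermxP uB.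
  have /eqP := congr1 (fun A => (A *m (map_mx Num.conj u)^T) 0 0) uB.
  rewrite mul0mx [X in _ == X]mxE /B mulmx_sumr mulmx_suml summxE.
  have uE s : (u *m (W s *m (map_mx Num.conj (W s))^T) *m (map_mx Num.conj u)^T) 0 0 =
      \sum_i `|(u *m W s) 0 i| ^+ 2.
    rewrite !mulmxA -mulmxA -trmx_mul -map_mxM mxE; apply: eq_bigr => i _.
    by rewrite [in RHS]normCK !mxE.
  under eq_bigr do rewrite uE.
  rewrite psumr_eq0 => [|s _]; last by apply: sumr_ge0 => i _; rewrite exprn_ge0.
  move/allP/(_ 1%g); rewrite mem_index_enum group1 => /(_ isT) /=.
  rewrite psumr_eq0 => [/allP u0|i _]; last by rewrite exprn_ge0.
  apply/rowP => i; have := u0 i; rewrite mem_index_enum => /(_ isT) /=.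
  by rewrite expf_eq0 normr_eq0 repr_mx1 mulmx1 mxE => /eqP.
have E : W x^-1%g = B *m (map_mx Num.conj (W x))^T *m invmx B.
  apply: (canRL (mulmxK Bu)).
  by rewrite -{1}BW !mulmxA -repr_mxM ?groupV // mulVg repr_mx1 mul1mx.
rewrite E mxtrace_mulC mulmxA mulVmx // mul1mx mxtrace_tr.
by rewrite /mxtrace rmorph_sum; apply: eq_bigr => i _; rewrite mxE.
Qed.

(** * Traces on tensor products over the group algebra *)

Section TensorTrace.
Variables (C : numFieldType) (gT : finGroupType) (H : {group gT}).
Local Notation K := (subg_of H).
Local Notation gbim := (gbim C H).
Local Notation "v ⊗ w" := (gt v w) (at level 40, left associativity).
Local Notation app phi v := ((phi : 'Hom(_, C^o)) v).

Section Contraction.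
Variables V T : gbim.

(** Up to the factor 1 / |H|, the map V (x) T -> T that evaluates phi on the first
    factor and lets the resulting element of CH act on the second. *)
Definition contract (phi : gdual V) : 'Hom(gtens V T, T) :=
  blift (fun v y => #|K|%:R^-1 *: \sum_h app phi (ract V h^-1%g v) *: lact T h y).

Lemma contractE phi v y :
  contract phi (v ⊗ y) = #|K|%:R^-1 *: \sum_h app phi (ract V h^-1%g v) *: lact T h y.
Proof.
apply: bliftE => [|k {}v {}y].
  split=> [{}v k x z|{}y k x z]; rewrite scalerA mulrC -scalerA -scalerDr;
    congr (_ *: _); rewrite scaler_sumr -big_split; apply: eq_bigr => h _ /=.
    by rewrite linearP scalerDr !scalerA mulrC.
  by rewrite !linearP /= scalerDl scalerA.
congr (_ *: _); rewrite (reindex_inj (mulIg k)); apply: eq_bigr => h _ /=.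
by rewrite -ractM invMg mulKVg lactM.
Qed.

(** The averaging factor in [contract] is what makes the dual bases (e_i) of V and
    (e^i) of V^* a decomposition of the identity of a tensor product over CH. *)
Lemma casimir_tensor (v : V) (y : T) :
  \sum_(i < \dim {:V}) (vbasis {:V})`_i ⊗ contract (cobasis i) (v ⊗ y) = v ⊗ y.
Proof.
under eq_bigr do rewrite contractE gtZr gt_sumr.
rewrite -scaler_sumr exchange_big /=.
transitivity (#|K|%:R^-1 *: \sum_(h : K) v ⊗ y); last first.
  by rewrite sumr_const -scaler_nat scalerA mulVf ?scale1r ?card_K_neq0.
congr (_ *: _); apply: eq_bigr => h _.
transitivity (ract V h^-1%g v ⊗ lact T h y).
  rewrite [in RHS](coord_vbasis (memvf (ract V h^-1%g v))) gt_suml.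
  by apply: eq_bigr => i _; rewrite cobasisE gtZr gtZl.
by rewrite gt_bal -lactM mulVg lact1.
Qed.

(** By [casimir_tensor] the products of basis vectors span V (x) T, with
    coordinates read off after contracting with a cobasis vector; this reduces a
    trace over a quotient space, which has no preferred basis, to traces on T. *)
Lemma ltrace_gtens (L : gtens V T -> gtens V T) : linear L ->
  ltrace L = \sum_(i < \dim {:V})
    ltrace (fun y => contract (cobasis i) (L ((vbasis {:V})`_i ⊗ y))).
Proof.
move=> LL.
pose u (ij : 'I_(\dim {:V}) * 'I_(\dim {:T})) :=
  (vbasis {:V})`_ij.1 ⊗ (vbasis {:T})`_ij.2.
pose c (ij : 'I_(\dim {:V}) * 'I_(\dim {:T})) : 'Hom(gtens V T, C^o) :=
  ((linfun (coord (vbasis {:T}) ij.2 : T -> C^o)) \o contract (cobasis ij.1))%VF.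
have cE ij x : c ij x = coord (vbasis {:T}) ij.2 (contract (cobasis ij.1) x).
  by rewrite comp_lfunE linfunE // => k y z; rewrite linearP.
rewrite (ltrace_frame (u := u) (c := c)) //.
  rewrite -(pair_bigA _ (fun i j => c (i, j) (L (u (i, j))) : C)) /=.
  by apply: eq_bigr => i _; apply: eq_bigr => j _; rewrite cE.
move=> x; elim/gtens_ind: x => [|x y IHx IHy|v y].
- by rewrite big1 // => ij _; rewrite linear0 scale0r.
- rewrite [LHS](f_equal2 _ IHx IHy) -big_split; apply: eq_bigr => ij _.
  by rewrite /= linearD scalerDl.
rewrite -[LHS]casimir_tensor.
rewrite -(pair_bigA _ (fun i j => (c (i, j) (v ⊗ y) : C) *: u (i, j))) /=.
apply: eq_bigr => i _; rewrite {1}(coord_vbasis (memvf (contract _ _))) gt_sumr.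
by apply: eq_bigr => j _; rewrite cE gtZr.
Qed.

(** Right translation by h <> 1 moves every homogeneous component to another one,
    hence has no diagonal entry in a homogeneous basis. *)
Lemma ltrace_ract (h : K) : ltrace (ract V h) = ((h == 1%g) * \dim {:V})%:R.
Proof.
case: eqVneq => [->|h1].
  rewrite mul1n -ltrace_id; apply: eq_ltrace => v; exact: ract1.
rewrite mul0n.
rewrite (@eq_ltrace _ _ _ (fun v => \sum_g ract V h (gcomp V g v))); last first.
  by move=> v; rewrite -linear_sum gcomp_sum.
rewrite ltrace_sum big1 // => g _.
rewrite (@eq_ltrace _ _ _ ((fun v => ract V h (gcomp V g v)) \o gcomp V g)); last first.
  by move=> v /=; rewrite (gcompE _ (gcomp_in g v)) eqxx.
rewrite ltrace_cycle; try by move=> k x y; rewrite ?linearP // !linearP.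
rewrite /ltrace big1 // => i _ /=.
have := ract_homog h (gcomp_in g (vbasis {:V})`_i) => /gcompE->.
rewrite -{1}[g]mulg1 (inj_eq (mulgI g)).
case: eqP => [/esym e1|]; last by rewrite linear0.
by case/eqP: h1; apply: val_inj.
Qed.

(** The trace of the identity is an average over h in H of the product of the
    traces of v |-> v h^-1 on V and y |-> h y on T, and only h = 1 contributes. *)
Lemma dim_gtens : (\dim {:gtens V T})%:R = (\dim {:V})%:R * (\dim {:T})%:R / #|K|%:R :> C.
Proof.
rewrite -ltrace_id ltrace_gtens //.
transitivity (#|K|%:R^-1 * \sum_h ltrace (ract V h^-1%g) * ltrace (lact T h)).
  under [LHS]eq_bigr => i _.
    rewrite (eq_ltrace (contractE _ _)) ltraceZ ltrace_sum.
    under eq_bigr do rewrite ltraceZ cobasisE.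
    over.
  rewrite -mulr_sumr exchange_big; congr (_ * _); apply: eq_bigr => h _ /=.
  by rewrite mulr_suml.
rewrite (bigD1 1%g) //= big1 ?addr0 => [|h h1].
  rewrite invg1 ltrace_ract eqxx mul1n mulrC; congr (_ * _ / _).
  rewrite -ltrace_id; apply: eq_ltrace => y; exact: lact1.
by rewrite ltrace_ract eq_invg1 (negPf h1) mul0r.
Qed.

End Contraction.
End TensorTrace.

(** * Subobjects and kernels *)

Section Subobject.
Variables (C : fieldType) (gT : finGroupType) (H : {group gT}).
Local Notation gbim := (gbim C H).

Section Stable.
Variables (Y : gbim) (U : {vspace Y}).

Definition stable (a : 'End(Y)) := forall v, v \in U -> a v \in U.

Definition restr (a : 'End(Y)) : 'End(subvs_of U) :=
  linfun (vsproj U \o a \o vsval).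

Lemma restrE a x : stable a -> vsval (restr a x) = a (vsval x).
Proof. by move=> aU; rewrite lfunE /= vsprojK ?aU ?subvsP. Qed.

Hypotheses (gU : forall g, stable (gcomp Y g))
  (lU : forall h, stable (lact Y h)) (rU : forall h, stable (ract Y h)).

Local Notation p := (fun g => restr (gcomp Y g)).
Local Notation l := (fun h => restr (lact Y h)).
Local Notation r := (fun h => restr (ract Y h)).

Lemma restr_sum x : \sum_g p g x = x.
Proof.
apply: val_inj; rewrite /= linear_sum -[RHS]gcomp_sum.
by apply: eq_bigr => g _; exact: restrE.
Qed.
Lemma restr_pp g y x : p g (p y x) = if g == y then p y x else 0.
Proof.
apply: val_inj; rewrite /= restrE // restrE // (gcompE _ (gcomp_in _ _)).
by case: ifP => _; rewrite ?restrE ?linear0.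
Qed.
Lemma restr_l1 x : l 1%g x = x.
Proof. by apply: val_inj; rewrite /= restrE // lact1. Qed.
Lemma restr_lM h k x : l (h * k)%g x = l h (l k x).
Proof. by apply: val_inj; rewrite /= !restrE // lactM. Qed.
Lemma restr_r1 x : r 1%g x = x.
Proof. by apply: val_inj; rewrite /= restrE // ract1. Qed.
Lemma restr_rM h k x : r (h * k)%g x = r k (r h x).
Proof. by apply: val_inj; rewrite /= !restrE // ractM. Qed.
Lemma restr_lr h k x : r k (l h x) = l h (r k x).
Proof. by apply: val_inj; rewrite /= !restrE // lractC. Qed.
Lemma restr_pl g h x : p (sgval h * g)%g (l h x) = l h (p g x).
Proof. by apply: val_inj; rewrite /= !restrE // gcomp_lact. Qed.
Lemma restr_pr g h x : p (g * sgval h)%g (r h x) = r h (p g x).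
Proof. by apply: val_inj; rewrite /= !restrE // gcomp_ract. Qed.

Definition sub_gbim : gbim :=
  mk_gbim restr_sum restr_pp restr_l1 restr_lM restr_r1 restr_rM restr_lr
    restr_pl restr_pr.

Definition sub_inclr : 'Hom(sub_gbim, Y) := linfun (@vsval C Y U).

Lemma sub_inclrE x : sub_inclr x = vsval x.
Proof. by rewrite lfunE. Qed.

Lemma sub_inclr_mor : is_mor sub_inclr.
Proof.
split=> [h x|h x|g x xg]; rewrite !sub_inclrE; try exact: restrE.
have /eqP <- : restr (gcomp Y g) x == x by move: xg; rewrite gcomp_id mk_gcomp.
by rewrite restrE // gcomp_in.
Qed.
Definition sub_incl : ghom sub_gbim Y := mk_mor sub_inclr_mor.

Lemma sub_inclE x : gfun sub_incl x = vsval x.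
Proof. exact: sub_inclrE. Qed.

Lemma sub_corestr_mor (X : gbim) (f : ghom X Y) (fU : forall x, gfun f x \in U) :
  is_mor (linfun (vsproj U \o gfun f) : 'Hom(X, sub_gbim)).
Proof.
have E x : vsval ((linfun (vsproj U \o gfun f) : 'Hom(X, sub_gbim)) x : subvs_of U) = gfun f x.
  by rewrite lfunE /= vsprojK.
have [fl fr fh] := gfunP f.
split=> [h x|h x|g x xg].
- by apply: val_inj; rewrite /= E fl -E; apply/esym/restrE.
- by apply: val_inj; rewrite /= E fr -E; apply/esym/restrE.
rewrite gcomp_id mk_gcomp; apply/eqP/val_inj; rewrite /= restrE // E.
by apply/eqP; rewrite -gcomp_id fh.
Qed.
End Stable.

Section Kernel.
Variables (U Y : gbim) (f : ghom U Y).

Lemma mor_gcomp g v : gfun f (gcomp U g v) = gcomp Y g (gfun f v).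
Proof.
have /homspaceP := gfunP f; rewrite memv_cap => /andP[_ /memv_bigcap/(_ g)].
by move/commutantP/(_ v).
Qed.

Lemma ker_gcomp g : stable (lker (gfun f)) (gcomp U g).
Proof. by move=> v; rewrite !memv_ker mor_gcomp => /eqP->; rewrite linear0. Qed.
Lemma ker_lact h : stable (lker (gfun f)) (lact U h).
Proof.
by have [fl _ _] := gfunP f => v; rewrite !memv_ker fl => /eqP->; rewrite linear0.
Qed.
Lemma ker_ract h : stable (lker (gfun f)) (ract U h).
Proof.
by have [_ fr _] := gfunP f => v; rewrite !memv_ker fr => /eqP->; rewrite linear0.
Qed.

Definition ker_gbim := sub_gbim ker_gcomp ker_lact ker_ract.
Definition ker_incl : ghom ker_gbim U := sub_incl ker_gcomp ker_lact ker_ract.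

Lemma ker_incl_inj : lker (gfun ker_incl) == 0%VS.
Proof. by apply/lker0P => x y; rewrite !sub_inclE; exact: val_inj. Qed.

Lemma ker_incl_lker x : gfun f (gfun ker_incl x) = 0.
Proof. by apply/eqP; rewrite -memv_ker sub_inclE subvsP. Qed.

End Kernel.
End Subobject.

(** * Complete reducibility *)

Lemma dim0P (C : fieldType) (V : vectType C) : (forall v : V, v = 0) <-> \dim {:V} = 0%N.
Proof.
split=> [V0|/eqP]; last by rewrite dimv_eq0 => /eqP V0 v; apply/eqP; rewrite -memv0 -V0 memvf.
by apply/eqP; rewrite dimv_eq0 -subv0; apply/subvP => v _; rewrite (V0 v) mem0v.
Qed.

(** The trace of a \o b on A is that of b \o a on B, which is the dimension of B. *)
Lemma dim_split (C : numFieldType) (A B B' : vectType C)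
    (a : B -> A) (b : A -> B) (a' : B' -> A) (b' : A -> B') :
  linear a -> linear b -> linear a' -> linear b' ->
  cancel a b -> cancel a' b' -> (forall x, a (b x) + a' (b' x) = x) ->
  \dim {:A} = (\dim {:B} + \dim {:B'})%N.
Proof.
move=> aL bL aL' bL' ab ab' s; apply/eqP; rewrite -(eqr_nat C) natrD -!ltrace_id.
rewrite -(eq_ltrace s) ltraceD; apply/eqP; congr (_ + _).
  by rewrite -(eq_ltrace ab) -ltrace_cycle.
by rewrite -(eq_ltrace ab') -ltrace_cycle.
Qed.

Lemma dim_can (C : numFieldType) (A B : vectType C) (a : B -> A) (b : A -> B) :
  linear a -> linear b -> cancel a b -> cancel b a -> \dim {:A} = \dim {:B}.
Proof.
move=> aL bL ab ba; apply/eqP; rewrite -(eqr_nat C) -!ltrace_id.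
by rewrite -(eq_ltrace ab) -(eq_ltrace ba) -ltrace_cycle.
Qed.

Section Maschke.
Variables (C : numFieldType) (gT : finGroupType) (H : {group gT}).
Local Notation K := (subg_of H).
Local Notation gbim := (gbim C H).

(** Maschke's argument: project a linear retraction to its degree-preserving part,
    then average over the left and the right action of H. *)
Lemma gretract (U Y : gbim) (f : ghom U Y) : lker (gfun f) == 0%VS ->
  exists q : ghom Y U, forall x, gfun q (gfun f x) = x.
Proof.
move=> fI; have [fl fr fh] := gfunP f.
pose q0 : 'Hom(Y, U) := ((gfun f)^-1)%VF.
have q0K x : q0 (gfun f x) = x by rewrite lker0_lfunK.
pose q1 v := \sum_g gcomp U g (q0 (gcomp Y g v)).
have q1L : linear q1.
  move=> k x y; rewrite scaler_sumr -big_split; apply: eq_bigr => g _.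
  by rewrite !linearP.
have q1h g v : v \in homog Y g -> q1 v \in homog U g.
  move=> vg; rewrite /q1 (bigD1 g) //= big1 ?addr0 ?gcomp_in // => x xg.
  by rewrite (gcompE _ vg) (negPf xg) !linear0.
have q1K x : q1 (gfun f x) = x.
  rewrite -[RHS]gcomp_sum; apply: eq_bigr => g _.
  by rewrite -mor_gcomp q0K (gcompE _ (gcomp_in _ _)) eqxx.
(* The average still preserves degrees: the translations before q1 are undone
   after it. *)
pose c : C := (#|K|%:R * #|K|%:R)^-1.
pose q2 v := c *: \sum_h \sum_k
  lact U h^-1%g (ract U k^-1%g (q1 (ract Y k (lact Y h v)))).
have q2L : linear q2.
  move=> a x y; rewrite scalerA mulrC -scalerA -scalerDr; congr (_ *: _).
  rewrite scaler_sumr -big_split; apply: eq_bigr => h _ /=.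
  rewrite scaler_sumr -big_split; apply: eq_bigr => k _ /=.
  by rewrite !linearP q1L !linearP.
have q2M : is_mor q2.
  split=> [l v|l v|g v vg].
  - rewrite /q2 linearZ; congr (_ *: _); rewrite linear_sum.
    rewrite [RHS](reindex_inj (mulIg l)); apply: eq_bigr => h _ /=.
    rewrite linear_sum; apply: eq_bigr => k _.
    by rewrite /= -[in LHS]lactM -[in RHS](lactM l) invMg mulKVg.
  - rewrite /q2 linearZ; congr (_ *: _); rewrite linear_sum; apply: eq_bigr => h _ /=.
    rewrite linear_sum [RHS](reindex_inj (mulgI l)); apply: eq_bigr => k _ /=.
    by rewrite /= -[in LHS](lractC h l) -[in LHS](ractM l) [in RHS]lractC -[in RHS](ractM _ l)
      invMg mulgKV.
  rewrite memvZ // rpred_sum // => h _; rewrite rpred_sum // => k _.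
  have -> : g = (sgval h^-1%g * ((sgval h * g * sgval k) * sgval k^-1%g))%g.
    by rewrite mulgK mulKg.
  by apply/lact_homog/ract_homog/q1h/ract_homog/lact_homog.
have q2lM : is_mor (linfun q2 : 'Hom(Y, U)).
  have [q2l q2r q2h] := q2M.
  split=> [h v|h v|g v vg]; rewrite !(linfunE q2L).
  - exact: q2l.
  - exact: q2r.
  exact: q2h.
exists (mk_mor q2lM) => x; rewrite mk_morE linfunE // /q2.
transitivity (c *: \sum_(h : K) \sum_(k : K) x).
  congr (_ *: _); apply: eq_bigr => h _; apply: eq_bigr => k _.
  by rewrite -fl -fr q1K -ractM mulgV ract1 -lactM mulVg lact1.
rewrite !sumr_const -!scaler_nat !scalerA /c mulVf ?scale1r //.
by rewrite mulf_neq0 ?card_K_neq0.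
Qed.

Local Notation D := (gbimod C H).

(** The inclusion of the kernel is a morphism whose composite with f vanishes. *)
Lemma mono_injective (U Y : D) (f : mhom U Y) :
  mono_mor f -> lker (gfun (f : ghom U Y)) == 0%VS.
Proof.
move=> fm; have k0 : (ker_incl (f : ghom U Y) : @mhom _ D _ _) = 0.
  apply: fm; apply: ghomP => x; rewrite !cat_cmpE ker_incl_lker.
  by rewrite /gfun linear0 zero_lfunE linear0.
rewrite -subv0; apply/subvP => v vk.
have := congr1 (fun g : ghom (ker_gbim (f : ghom U Y)) U =>
  gfun g (Subvs vk : ker_gbim (f : ghom U Y))) k0.
by rewrite sub_inclE /= /gfun linear0 zero_lfunE => ->; rewrite mem0v.
Qed.

Lemma injective_mono (U Y : D) (f : mhom U Y) :
  lker (gfun (f : ghom U Y)) == 0%VS -> mono_mor f.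
Proof.
move=> /lker0P fI X g h gh; apply: ghomP => x; apply: fI.
by rewrite -!cat_cmpE gh.
Qed.

(** Complete reducibility as an induction principle: an object that is neither
    zero nor simple receives a non-invertible nonzero monomorphism, which splits
    by averaging, and both the subobject and its complement have smaller
    dimension. *)
Lemma gbim_ind (P : gbim -> Prop) :
  (forall Y : gbim, \dim {:Y} = 0%N -> P Y) ->
  (forall Y, @simple_obj C D Y -> P Y) ->
  (forall (Y U U' : gbim) (f : ghom U Y) (q : ghom Y U) (f' : ghom U' Y) (q' : ghom Y U'),
    (forall x, gfun q (gfun f x) = x) -> (forall x, gfun q' (gfun f' x) = x) ->
    (forall y, gfun f (gfun q y) + gfun f' (gfun q' y) = y) ->
    P U -> P U' -> P Y) ->
  forall Y, P Y.
Proof.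
move=> P0 P1 PD Y; have [n] := ubnP (\dim {:Y}); elim: n Y => // n IHn Y.
rewrite ltnS => Yn; have [Y0|Y0] := eqVneq (\dim {:Y}) 0%N; first exact: P0.
have [Ys|Yns] := classic (@simple_obj C D Y); first exact: P1.
have idY0 : @idm _ D Y <> 0.
  move=> id0; case/eqP: Y0; apply/dim0P => y.
  rewrite -[y](cat_idE (V := Y)); rewrite [idm _]id0.
  by rewrite /gfun linear0 zero_lfunE.
have [U [f [fm f0 fni]]] : exists U (f : @mhom _ D U Y),
    [/\ mono_mor f, f <> 0 & ~ exists g : @mhom _ D Y U,
       @cmp C D U Y U g f = idm U /\ @cmp C D Y U Y f g = idm (Y : D)].
  apply: NNPP => nex; apply: Yns; split=> // U f fm.
  apply: NNPP => fn; apply: nex; exists U, f; split=> // [f0|fg]; apply: fn.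
    by left.
  by right.
have fI := mono_injective fm.
have [q qf] := gretract fI.
have eker y : gfun q (y - gfun (f : ghom U Y) (gfun q y)) = 0.
  by rewrite linearB /= qf subrr.
have eE y : gfun (gid Y - gcmp (f : ghom U Y) q) y = y - gfun (f : ghom U Y) (gfun q y).
  have -> : gid Y - gcmp (f : ghom U Y) q = (- 1) *: gcmp (f : ghom U Y) q + gid Y.
    by rewrite scaleN1r addrC.
  by rewrite gfun_linear scaleN1r addrC gidE gcmpE.
have eU y : gfun (gid Y - gcmp (f : ghom U Y) q) y \in lker (gfun q).
  by rewrite eE memv_ker eker.
pose r := mk_mor (sub_corestr_mor (ker_gcomp (f:=q)) (ker_lact (f:=q)) (ker_ract (f:=q)) eU).
have rE y : vsval (gfun r y : subvs_of _) = y - gfun (f : ghom U Y) (gfun q y).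
  by rewrite mk_morE lfunE /= vsprojK ?eU // eE.
have dk : (\dim {:Y} = \dim {:U} + \dim {:ker_gbim q})%N.
  apply: (dim_split (a := gfun (f : ghom U Y)) (b := gfun q)
    (a' := gfun (ker_incl q)) (b' := gfun r)) => //; try by move=> k x y; rewrite linearP.
    by move=> x; apply: val_inj; rewrite /= rE ker_incl_lker linear0 subr0 sub_inclE.
  by move=> x; rewrite sub_inclE rE addrC subrK.
have U0 : \dim {:U} != 0%N.
  apply/eqP => /dim0P U0; apply: f0; apply: ghomP => x.
  by rewrite (U0 x) !linear0.
have k0 : \dim {:ker_gbim q} != 0%N.
  apply/eqP => /dim0P k0; apply: fni; exists (q : @mhom _ D Y U).
  split; apply: ghomP => x; rewrite cat_cmpE cat_idE //.
  by apply/esym/eqP; rewrite -subr_eq0 -rE (k0 (gfun r x)) linear0.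
apply: (PD Y U (ker_gbim q) f q (ker_incl q) r) => //.
- by move=> x; apply: val_inj; rewrite /= rE ker_incl_lker linear0 subr0 sub_inclE.
- by move=> x; rewrite sub_inclE rE addrC subrK.
- by apply: IHn; apply: leq_trans Yn; rewrite dk -[X in (X < _)%N]addn0 ltn_add2l lt0n.
by apply: IHn; apply: leq_trans Yn; rewrite dk -[X in (X < _)%N]add0n ltn_add2r lt0n.
Qed.
End Maschke.

(** * Schur's lemma and the canonical pivotal structure *)

(** The pivotal dimension of V is linear in the isomorphism from V to its bidual. *)
Lemma pivdim_scale (C : fieldType) (D : rigidCat C) (j j' : pivotal D) (V : D)
    (a d c : C) : idm (@munit _ D) <> 0 -> piv j V = c *: piv j' V ->
  is_pivdim j' V d -> is_pivdim j V a -> a = c * d.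
Proof.
move=> id0 jE jd'; have L := rigid_laws D.
rewrite /is_pivdim jE.
rewrite (GRing.scalable_linear ((tensm_bilin L _ _ _ _).2 (idm (dual V)))).
rewrite (GRing.scalable_linear ((cmp_bilin L _ _ _).1 (ev (dual V)))).
rewrite (GRing.scalable_linear ((cmp_bilin L _ _ _).2 (db V))) /= jd' scalerA.
move/eqP; rewrite -subr_eq0 -scalerBl scaler_eq0 => /orP[|/eqP//].
by rewrite subr_eq0 => /eqP.
Qed.

Section Schur.
Variables (C : numClosedFieldType) (gT : finGroupType) (H : {group gT}).
Local Notation K := (subg_of H).
Local Notation gbim := (gbim C H).
Local Notation D := (gbimod C H).
Local Open Scope mon_scope.

Lemma gfun0 (U V : gbim) v : gfun (0 : ghom U V) v = 0.
Proof. by rewrite /gfun linear0 zero_lfunE. Qed.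

Lemma simple_dim (V : gbim) : @simple_obj C D V -> \dim {:V} != 0%N.
Proof.
case=> V0 _; apply/eqP => /dim0P z; apply: V0; apply: ghomP => v.
by rewrite (z v) !linear0.
Qed.

(** The kernel of f cannot be all of V, so it is zero; then f is a nonzero
    monomorphism into a simple object. *)
Lemma simple_map (V X : D) (f : mhom V X) :
  simple_obj V -> simple_obj X -> f <> 0 ->
  exists g : mhom X V, g ∘ f = idm V /\ f ∘ g = idm X.
Proof.
move=> [_ Vs] [_ Xs] f0.
have fm : mono_mor f.
  apply: injective_mono.
  have km : @mono_mor C D _ _ (ker_incl (f : ghom V X)).
    exact/injective_mono/ker_incl_inj.
  have [k0|[g [_ kg]]] := Vs _ _ km.
    rewrite -subv0; apply/subvP => v vk.
    have := congr1 (fun g : ghom (ker_gbim (f : ghom V X)) V =>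
      gfun g (Subvs vk : ker_gbim (f : ghom V X))) k0.
    by rewrite sub_inclE /= gfun0 => ->; rewrite mem0v.
  case: f0; apply: ghomP => v; rewrite gfun0.
  rewrite -[v](cat_idE (V := V)) -kg cat_cmpE; exact: ker_incl_lker.
by have [//|] := Xs _ _ fm.
Qed.

(** Schur's lemma: f minus an eigenvalue is not injective, hence not invertible,
    hence zero. *)
Lemma simple_endo (V : D) (f : mhom V V) :
  simple_obj V -> exists a, f = a *: idm V.
Proof.
move=> Vs; have [a [v v0 fv]] := endo_eigenvector (gfun (f : ghom V V)) (simple_dim Vs).
exists a; apply: NNPP => fa.
have [|g [gf _]] := @simple_map V V (f - a *: idm V) Vs Vs.
  by move/eqP; rewrite subr_eq0 => /eqP.
case/eqP: v0; rewrite -[v](cat_idE (V := V)) -gf cat_cmpE.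
have -> : f - a *: idm V = (- a) *: idm V + f by rewrite scaleNr addrC.
by rewrite gfun_linear fv cat_idE scaleNr addNr linear0.
Qed.

Lemma dim_hom_simple (V X : D) (g : mhom X V) (f : mhom V X) :
  simple_obj V -> g ∘ f = idm V -> f ∘ g = idm X -> \dim {: mhom V X} = 1%N.
Proof.
move=> Vs gf fg.
have f0 : f != 0.
  apply/eqP => f0; case: Vs => [+ _]; apply.
  by rewrite -gf f0; apply: ghomP => v; rewrite cat_cmpE !gfun0 linear0.
suff -> : {: mhom V X}%VS = <[f]>%VS by rewrite dim_vline f0.
apply/eqP; rewrite eqEsubv subvf andbT; apply/subvP => u _.
have [a ga] := simple_endo (g ∘ u) Vs.
apply/vlineP; exists a.
have L := rigid_laws D.
rewrite -[u](cmp1m L) -fg -(cmpA L) ga.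
by rewrite (GRing.scalable_linear ((cmp_bilin L _ _ _).1 f)) (cmpm1 L).
Qed.

Lemma iso_dim (V X : D) : iso_obj V X -> \dim {:(V : gbim)} = \dim {:(X : gbim)}.
Proof.
case=> f [g [gf fg]].
apply: (dim_can (a := gfun (g : ghom X V)) (b := gfun (f : ghom V X))).
- by move=> k x y; rewrite linearP.
- by move=> k x y; rewrite linearP.
- by move=> x; rewrite -cat_cmpE fg cat_idE.
by move=> x; rewrite -cat_cmpE gf cat_idE.
Qed.

(** The number of copies of X i in a semisimple object Y is the dimension of
    Hom(Y, X i).  Both sides are additive in Y, and by Schur's lemma they agree
    when Y is simple. *)
Lemma sum_hom_dim n (X : 'I_n -> D) : simple_reps X -> forall Y : gbim,
  \sum_i (\dim {:(X i : gbim)})%:R * (\dim {: ghom Y (X i)})%:R = (\dim {:Y})%:R :> C.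
Proof.
move=> [Xs Xi XX]; elim/gbim_ind => [Y Y0|Y Ys|Y U U' f q f' q' qf qf' s IHU IHU'].
- rewrite Y0 big1 // => i _; have -> : \dim {: ghom Y (X i)} = 0%N.
    apply/dim0P => f; apply: ghomP => v.
    by move/dim0P : Y0 => Y0; rewrite (Y0 v) !linear0.
  by rewrite mulr0.
- have [i [f [g [gf fg]]]] := XX _ Ys.
  rewrite (bigD1 i) //= (dim_hom_simple Ys gf fg) mulr1.
  have -> : \dim {:Y} = \dim {:(X i : gbim)} by apply: iso_dim; exists f, g.
  rewrite big1 ?addr0 // => k ki; have -> : \dim {: ghom Y (X k)} = 0%N.
    apply/dim0P => u; apply: NNPP => u0.
    have [w [wu uw]] := simple_map Ys (Xs k) u0.
    case/eqP: ki; apply: Xi; exists (cmp (f : @mhom _ D Y (X i)) (w : @mhom _ D (X k) Y)), (cmp (u : @mhom _ D Y (X k)) (g : @mhom _ D (X i) Y)).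
    have L := rigid_laws D; split.
      by rewrite (cmpA L) -[X in X ∘ w](cmpA L) gf (cmpm1 L).
    by rewrite (cmpA L) -[X in X ∘ g](cmpA L) wu (cmpm1 L).
  by rewrite mulr0.
rewrite (dim_split (a := gfun f) (b := gfun q) (a' := gfun f') (b' := gfun q')) //;
  try by move=> k x y; rewrite linearP.
rewrite natrD -IHU -IHU' -big_split; apply: eq_bigr => i _ /=.
rewrite -mulrDr -natrD; congr (_ * _%:R).
apply: (dim_split (a := fun u : ghom U (X i) => gcmp u q) (b := fun u => gcmp u f)
   (a' := fun u : ghom U' (X i) => gcmp u q') (b' := fun u => gcmp u f')).
- exact: (gcmp_bilin _ _ _).2.
- exact: (gcmp_bilin _ _ _).2.
- exact: (gcmp_bilin _ _ _).2.
- exact: (gcmp_bilin _ _ _).2.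
- by move=> u; apply: ghomP => v; rewrite !gcmpE qf.
- by move=> u; apply: ghomP => v; rewrite !gcmpE qf'.
move=> u; apply: ghomP => v; rewrite -[gcmp (gcmp u f) q]scale1r gfun_linear scale1r.
by rewrite !gcmpE -linearD s.
Qed.

(** By [sum_hom_dim] and [dim_gtens] the dimensions of the simple objects form a
    positive left eigenvector of the fusion matrix of V, with eigenvalue
    dim V / |H|. *)
Lemma FPdimE (V : D) a : simple_obj V -> is_FPdim V a ->
  a = (\dim {:(V : gbim)})%:R / #|K|%:R.
Proof.
move=> Vs [n [X [XX a0 aE amax]]].
have [Xs _ XV] := XX.
have n0 : (0 < n)%N by case: (XV V Vs) => -[i ni] _; apply: leq_ltn_trans ni.
pose v i : C := (\dim {:(X i : gbim)})%:R.
have v0 i : 0 < v i by rewrite ltr0n lt0n; exact/simple_dim/Xs.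
have N0 i k : 0 <= fusion_mx X V i k by rewrite mxE ler0n.
have vN k : \sum_i v i * fusion_mx X V i k = (\dim {:(V : gbim)})%:R / #|K|%:R * v k.
  under eq_bigr do rewrite mxE.
  rewrite [LHS](sum_hom_dim XX (gtens V (X k))) dim_gtens.
  by rewrite mulrAC.
have [dE dmax] := perron_eigenvalue n0 N0 v0 vN.
apply/le_anti/andP; split; first exact: dmax.
by apply: amax dE; rewrite divr_ge0 ?ler0n.
Qed.

Lemma uone_neq0 : uone C H <> 0.
Proof.
move=> /ffunP/(_ 1%g); rewrite !ffunE eqxx => /eqP.
by rewrite oner_eq0.
Qed.

Section Pivotal.
Variable j : pivotal D.

(** How far j is from the standard structure v |-> (phi |-> phi v): an endomorphism
    of the identity functor, by [pivot_ratio_nat]. *)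
Definition pivot_ratio (V : gbim) : ghom V V := gcmp (spiv' V) (piv j V).

Lemma pivot_ratio_nat (V W : gbim) (f : ghom V W) v :
  gfun (pivot_ratio W) (gfun f v) = gfun f (gfun (pivot_ratio V) v).
Proof.
rewrite !gcmpE -[gfun (piv j W) _]gcmpE.
rewrite [gcmp (piv j W) f](piv_nat j (f : @mhom C D V W)) cat_cmpE.
set x := gfun (piv j V) v.
have {1}-> : x = gfun (spiv V) (gfun (spiv' V) x) by rewrite -gcmpE spiv'K gidE.
rewrite -[X in gfun (spiv' W) X]gcmpE -spiv_nat gcmpE.
by rewrite -[LHS]gcmpE spivK gidE.
Qed.

Lemma piv_ratioE (V : gbim) : piv j V = gcmp (spiv V) (pivot_ratio V).
Proof.
by apply: ghomP => v; rewrite gcmpE [gfun (pivot_ratio V) v]gcmpE -[RHS]gcmpE spiv'K gidE.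
Qed.

(** By Schur's lemma the ratio is a scalar c on V, so that the pivotal dimension of
    V for j is c times dim V / |H|; the latter is the Frobenius-Perron dimension,
    which forces c = 1. *)
Lemma pivot_ratio_simple (V : D) : canonical_pivotal j -> simple_obj V ->
  pivot_ratio V = gid V.
Proof.
move=> jc Vs; have [a /(FPdimE Vs) aE jV] := jc V Vs.
have [c cE] := simple_endo (pivot_ratio V : @mhom C D V V) Vs.
have jE : piv j V = c *: (piv (std_pivotal C H) V).
  rewrite piv_ratioE [pivot_ratio V]cE.
  apply: ghomP => v; rewrite gcmpE.
  by rewrite !gfunZE linearZ /= gidE.
have id0 : idm (@munit _ D) <> 0.
  move=> id0; apply: uone_neq0; rewrite -(gidE (uone C H)).
  by rewrite -[RHS](gfun0 _ (uone C H)); congr (gfun _ _); exact: id0.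
have := pivdim_scale id0 jE (std_pivdim V) jV.
rewrite -aE; have a0 : a != 0.
  by rewrite aE mulf_neq0 ?invr_neq0 ?card_K_neq0 // pnatr_eq0 simple_dim.
by rewrite -{1}[a]mul1r => /(mulIf a0) c1; rewrite cE -c1 scale1r.
Qed.

(** A natural endomorphism that is the identity on simple objects is the identity
    on all their sums, hence everywhere. *)
Lemma canonical_pivotalE (V : gbim) : canonical_pivotal j -> piv' j V = spiv' V.
Proof.
move=> jc; have r1 : pivot_ratio V = gid V.
  elim/gbim_ind: V => [Y Y0|Y Ys|Y U U' f q f' q' qf qf' s IHU IHU'].
  - by apply: ghomP => v; move/dim0P : Y0 => Y0; rewrite (Y0 v) !linear0.
  - exact: pivot_ratio_simple.
  apply: ghomP => v; rewrite gidE -[v in LHS]s linearD /=.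
  by rewrite (pivot_ratio_nat f) (pivot_ratio_nat f') IHU IHU' !gidE.
have jV : piv j V = spiv V by rewrite piv_ratioE r1; apply: ghomP => v; rewrite gcmpE gidE.
apply: ghomP => x.
rewrite -{1}[x]gidE -spiv'K gcmpE -jV.
have := congr1 (fun f : ghom V V => gfun f (gfun (spiv' V) x)) (pivK j V).
by rewrite cat_cmpE cat_idE.
Qed.
End Pivotal.
End Schur.

(** * The rotation as a map of vector spaces *)

Section Indicator.
Variables (C : numFieldType) (gT : finGroupType) (H : {group gT}).
Local Notation K := (subg_of H).
Local Notation gbim := (gbim C H).
Local Notation D := (gbimod C H).
Local Notation CH := {ffun K -> C^o}.
Local Notation "v ⊗ w" := (gt v w) (at level 40, left associativity).
Local Notation app phi v := ((phi : 'Hom(_, C^o)) v).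

(** A morphism CH -> X is determined by the image of 1, which can be any element of
    degree 1 that commutes with H; [central_proj] projects onto these elements. *)
Section Invariants.
Variable X : gbim.

Definition central_proj (x : X) : X :=
  #|K|%:R^-1 *: \sum_k ract X k^-1%g (lact X k (gcomp X 1%g x)).

Lemma central_proj_linear : linear central_proj.
Proof.
move=> a x y; rewrite scalerA mulrC -scalerA -scalerDr; congr (_ *: _).
by rewrite scaler_sumr -big_split; apply: eq_bigr => k _; rewrite /= !linearP.
Qed.

Lemma central_projC k x : lact X k (central_proj x) = ract X k (central_proj x).
Proof.
rewrite !linearZ; congr (_ *: _) => /=; rewrite !linear_sum /=.
rewrite [RHS](reindex_inj (mulgI k)); apply: eq_bigr => h _ /=.
by rewrite -[in RHS]ractM invMg mulgKV [in RHS]lactM [in RHS]lractC.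
Qed.

Lemma central_proj_homog x : central_proj x \in homog X 1%g.
Proof.
rewrite memvZ // rpred_sum // => k _.
have -> : homog X 1%g = homog X (sgval k * 1 * sgval k^-1)%g.
  by rewrite mulg1 mulgV.
exact/ract_homog/lact_homog/gcomp_in.
Qed.

Lemma central_proj_id (f : ghom (gunit C H) X) :
  central_proj (gfun f (uone C H)) = gfun f (uone C H).
Proof.
have [fl fr fh] := gfunP f.
rewrite /central_proj (gcompE _ (fh _ _ (uone_homog C H))) eqxx.
under eq_bigr => k _.
  rewrite -fl -fr uone_lact -uone_ract -ractM mulgV ract1.
  over.
by rewrite sumr_const -scaler_nat scalerA mulVf ?scale1r ?card_K_neq0.
Qed.

Definition unit_mapr (x : X) : 'Hom(gunit C H, X) :=
  linfun (fun a : gunit C H => \sum_h (a : CH) h *: lact X h (central_proj x)).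

Lemma unit_maprE x (a : gunit C H) :
  unit_mapr x a = \sum_h (a : CH) h *: lact X h (central_proj x).
Proof.
rewrite linfunE // => k b c; rewrite scaler_sumr -big_split.
by apply: eq_bigr => h _; rewrite !ffunE scalerDl scalerA.
Qed.

Lemma unit_mapr_mor x : is_mor (unit_mapr x).
Proof.
split=> [h a|h a|g a ag]; rewrite !unit_maprE.
- rewrite linear_sum (reindex_inj (mulgI h)); apply: eq_bigr => k _ /=.
  by rewrite [RHS]linearZ /= lactM ulactE mulKg.
- rewrite linear_sum (reindex_inj (mulIg h)); apply: eq_bigr => k _ /=.
  by rewrite [RHS]linearZ /= lactM uractE mulgK central_projC lractC.
rewrite rpred_sum // => k _; case: (eqVneq (sgval k) g) => [<-|kg].
  by rewrite memvZ // -[sgval k]mulg1 lact_homog // central_proj_homog.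
by have /gunit_homog -> // := ag; rewrite scale0r mem0v.
Qed.

Definition unit_map x : ghom (gunit C H) X := mk_mor (unit_mapr_mor x).

Lemma unit_map_uone x : gfun (unit_map x) (uone C H) = central_proj x.
Proof.
rewrite mk_morE unit_maprE (bigD1 1%g) //= ffunE eqxx scale1r lact1 big1 ?addr0 //.
by move=> h h1; rewrite ffunE (negPf h1) scale0r.
Qed.

Lemma unit_map_ext (f g : ghom (gunit C H) X) :
  gfun f (uone C H) = gfun g (uone C H) -> f = g.
Proof.
have [fl _ _] := gfunP f; have [gl _ _] := gfunP g.
move=> fg; apply: ghomP => a; rewrite (uone_gen a) !linear_sum.
by apply: eq_bigr => h _; rewrite !linearZ /= fl gl fg.
Qed.

Lemma unit_map_linear : linear unit_map.
Proof.
move=> k x y; apply: unit_map_ext.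
by rewrite gfun_linear !unit_map_uone central_proj_linear.
Qed.

(** Evaluation at 1 embeds Hom(CH, X) in X, with retraction [unit_map]; a trace is
    invariant under such a cyclic rearrangement. *)
Lemma ltrace_unit_hom (F : ghom (gunit C H) X -> ghom (gunit C H) X) :
  linear F -> ltrace F = ltrace (fun x => gfun (F (unit_map x)) (uone C H)).
Proof.
move=> FL; pose a (f : ghom (gunit C H) X) := gfun f (uone C H).
have aL : linear a by move=> k f g; exact: gfun_linear.
have aK f : unit_map (a f) = f.
  by apply: unit_map_ext; rewrite unit_map_uone central_proj_id.
transitivity (ltrace ((F \o unit_map) \o a)).
  by apply: eq_ltrace => f /=; rewrite aK.
by rewrite ltrace_cycle // => k x y; rewrite /= unit_map_linear FL.
Qed.
End Invariants.

Section Turn.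
Variables V T : gbim.

(** The rotation that moves the first tensor factor to the end.  For elements v and
    y the product y (x) v depends on more than v (x) y when the tensor product is
    over CH; averaging over h makes it well defined. *)
Definition turn : 'Hom(gtens V T, gtens T V) :=
  blift (fun v y => #|K|%:R^-1 *: \sum_h lact T h y ⊗ ract V h^-1%g v).

Lemma turnE v y :
  turn (v ⊗ y) = #|K|%:R^-1 *: \sum_h lact T h y ⊗ ract V h^-1%g v.
Proof.
apply: bliftE => [|k {}v {}y].
  split=> [{}v k x z|{}y k x z]; rewrite scalerA mulrC -scalerA -scalerDr;
    congr (_ *: _); rewrite scaler_sumr -big_split; apply: eq_bigr => h _ /=.
    by rewrite linearP gtDl gtZl.
  by rewrite linearP gtDr gtZr.
congr (_ *: _); rewrite (reindex_inj (mulIg k)); apply: eq_bigr => h _ /=.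
by rewrite -ractM invMg mulKVg lactM.
Qed.

(** In T (x) V, unlike in V (x) T, the factors k^-1 and k meet at the tensor sign
    and cancel. *)
Lemma turn_conj k x :
  turn (ract (gtens V T) k^-1%g (lact (gtens V T) k x)) = turn x.
Proof.
elim/gtens_ind: x => [|x y IHx IHy|v y]; first by rewrite !linear0.
  by rewrite !linearD /= IHx IHy.
rewrite lact_bt ract_bt !turnE; congr (_ *: _); apply: eq_bigr => h _.
by rewrite -lractC gt_bal lractC -lactM mulVg lact1.
Qed.

Lemma turn_central x : turn (central_proj x) = turn (gcomp (gtens V T) 1%g x).
Proof.
rewrite linearZ linear_sum /=; under eq_bigr do rewrite turn_conj.
by rewrite sumr_const -scaler_nat scalerA mulVf ?scale1r ?card_K_neq0.
Qed.
End Turn.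

Lemma spiv_cobasis (V : gbim) u :
  \sum_(i < \dim {:gdual V}) app (vbasis {:gdual V})`_i u *: cobasis (V := gdual V) i
  = gfun (spiv V) u.
Proof.
apply/lfunP => phi; rewrite sum_lfunE spivE.
rewrite {2}(coord_vbasis (memvf phi)) sum_lfunE.
by apply: eq_bigr => i _; rewrite !scale_lfunE cobasisE; exact: mulrC.
Qed.

(** On v (x) y, evaluating the dual basis at v h^-1 and recombining it with the
    bidual basis reconstructs the bidual vector of v h^-1. *)
Lemma turn_dual (V T : gbim) (x : gtens V T) :
  #|K|%:R^-1 *: (\sum_(i < \dim {:gdual V})
    gfun (gtensm (gid T) (spiv' V)) (gfun (glun (gtens T (gdual (gdual V))))
      (gfun (gtensm (gev V) (gid (gtens T (gdual (gdual V)))))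
        (gfun (gasc' (gdual V) V (gtens T (gdual (gdual V))))
          ((vbasis {:gdual V})`_i ⊗
            gfun (gasc V T (gdual (gdual V))) (x ⊗ cobasis (V := gdual V) i)))))) =
  turn V T x.
Proof.
elim/gtens_ind: x => [|x y IHx IHy|v y].
- by rewrite linear0 big1 ?scaler0 // => i _; rewrite gt0l linear0 gt0r !linear0.
- rewrite [RHS]linearD -[RHS](f_equal2 _ IHx IHy) -scalerDr -big_split.
  by congr (_ *: _); apply: eq_bigr => i _; rewrite gtDl linearD gtDr !linearD.
rewrite turnE; congr (_ *: _).
transitivity (\sum_(i < \dim {:gdual V}) \sum_h
  app (vbasis {:gdual V})`_i (ract V h^-1%g v) *:
    (lact T h y ⊗ gfun (spiv' V) (cobasis (V := gdual V) i))).
  apply: eq_bigr => i _; rewrite gascE gasc'E gtensmE gidE glunE linear_sum.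
  by apply: eq_bigr => h _; rewrite linearZ /= gevE lact_bt gtensmE gidE.
rewrite exchange_big; apply: eq_bigr => h _ /=.
under eq_bigr do rewrite -gtZr -linearZ.
by rewrite -gt_sumr -linear_sum /= spiv_cobasis -gcmpE spivK gidE.
Qed.

Lemma turn_chain (V T : gbim) (f : ghom (gunit C H) (gtens V T)) :
  gfun (gtensm (gid T) (spiv' V)) (gfun (glun (gtens T (gdual (gdual V))))
    (gfun (gtensm (gev V) (gid (gtens T (gdual (gdual V)))))
      (gfun (gasc' (gdual V) V (gtens T (gdual (gdual V))))
        (gfun (gtensm (gid (gdual V)) (gasc V T (gdual (gdual V))))
          (gfun (gtensm (gid (gdual V)) (gtensm f (gid (gdual (gdual V)))))
            (gfun (gtensm (gid (gdual V)) (glun' (gdual (gdual V))))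
              (#|K|%:R^-1 *: casimir (gdual V)))))))) =
  turn V T (gfun f (uone C H)).
Proof.
rewrite /casimir !(linearZ, linear_sum) /= -turn_dual; congr (_ *: _).
apply: eq_bigr => i _.
by do 3![rewrite gtensmE]; rewrite !gidE glun'E gtensmE gidE.
Qed.

(** [FS_map] is a composite of this shape. *)
Lemma cat_cmp9E (V0 V1 V2 V3 V4 V5 V6 V7 V8 V9 : D) (f1 : mhom V0 V1)
    (f2 : mhom V1 V2) (f3 : mhom V2 V3) (f4 : mhom V3 V4) (f5 : mhom V4 V5)
    (f6 : mhom V5 V6) (f7 : mhom V6 V7) (f8 : mhom V7 V8) (f9 : mhom V8 V9) v :
  gfun (f9 ∘ f8 ∘ f7 ∘ f6 ∘ f5 ∘ f4 ∘ f3 ∘ f2 ∘ f1 : ghom _ _)%mon v =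
  gfun (f9 : ghom _ _) (gfun (f8 : ghom _ _) (gfun (f7 : ghom _ _)
    (gfun (f6 : ghom _ _) (gfun (f5 : ghom _ _) (gfun (f4 : ghom _ _)
      (gfun (f3 : ghom _ _) (gfun (f2 : ghom _ _) (gfun (f1 : ghom _ _) v)))))))).
Proof. by rewrite !cat_cmpE. Qed.

Lemma FS_map_uone (j : pivotal D) (V : gbim) n
    (f : ghom (gunit C H) (gtens V (@tpow C D V n))) :
  piv' j V = spiv' V ->
  gfun (@FS_map C D j V n f : ghom _ _) (uone C H) =
  gfun (@tpow_rot C D V n : ghom _ _) (turn V (@tpow C D V n) (gfun f (uone C H))).
Proof.
move=> jV; apply: etrans (cat_cmp9E _ _ _ _ _ _ _ _ _ _) _.
rewrite -turn_chain jV; congr (gfun _ _).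
by rewrite cat_dbE.
Qed.
End Indicator.

(** * Tracing out the tensor factors *)

Section RotationTrace.
Variables (C : numFieldType) (gT : finGroupType) (H : {group gT}).
Local Notation K := (subg_of H).
Local Notation gbim := (gbim C H).
Local Notation D := (gbimod C H).
Local Notation CH := {ffun K -> C^o}.
Local Notation "v ⊗ w" := (gt v w) (at level 40, left associativity).
Local Notation app phi v := ((phi : 'Hom(_, C^o)) v).
Variable V : gbim.
Local Notation T n := (@tpow C D V n : gbim).

Definition rotm n : ghom (gtens (T n) V) (gtens V (T n)) := @tpow_rot C D V n.

Lemma rot0E (a : gunit C H) w :
  gfun (rotm 0) (a ⊗ w) = (\sum_h (a : CH) h *: lact V h w) ⊗ uone C H.
Proof.
apply: etrans (gcmpE (grun' V) (glun V) (a ⊗ w)) _.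
by rewrite glunE grun'E.
Qed.

Lemma rotSE n v y w :
  gfun (rotm n.+1) ((v ⊗ y : T n.+1) ⊗ w) = v ⊗ gfun (rotm n) (y ⊗ w).
Proof.
apply: etrans (gcmpE (gtensm (gid V) (rotm n)) (gasc V (T n) V) _) _.
by rewrite gascE gtensmE gidE.
Qed.

Lemma ltrace_unit (L : gunit C H -> gunit C H) : linear L ->
  ltrace L = \sum_c (L (lact (gunit C H) c (uone C H)) : CH) c.
Proof.
move=> LL.
pose ev c : 'Hom(gunit C H, C^o) := linfun (fun a : gunit C H => (a : CH) c).
have evE c a : ev c a = (a : CH) c by rewrite linfunE // => k x y; rewrite !ffunE.
rewrite (ltrace_frame (u := fun c : K => lact (gunit C H) c (uone C H)) (c := ev)) //.
  by apply: eq_bigr => c _; rewrite evE.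
by move=> x; rewrite [LHS]uone_gen; apply: eq_bigr => c _; rewrite evE.
Qed.

(** Let y run over the last tensor factors of V (x) T n and rotate w past them: the
    trace of this map is the part of the trace of the rotation on V (x) T n that
    remains once the first factor is fixed, phi being its coordinate form.  The
    degree of y is prescribed to be g, and h is the group element left at the
    first tensor sign by the averaging in [turn] or [contract]. *)
Definition rot_map n (phi : gdual V) (h : K) (g : gT) (w : V) (y : T n) : T n :=
  contract (T n) phi (gfun (rotm n) (lact (T n) h (gcomp (T n) g y) ⊗ w)).

Lemma rot_map_linear n phi h g w : linear (@rot_map n phi h g w).
Proof. by move=> k x y; rewrite /rot_map !linearP gtDl gtZl !linearP. Qed.

Lemma dual_trace (phi : gdual V) (A : V -> V) (u : V) : linear A ->
  \sum_(i < \dim {:V}) app phi (A (vbasis {:V})`_i) * app (cobasis i) u = app phi (A u).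
Proof.
move=> AL; rewrite -(linfunE AL u) [in RHS](coord_vbasis (memvf u)) !linear_sum.
by apply: eq_bigr => i _; rewrite !linearZ /= (linfunE AL) cobasisE; exact: mulrC.
Qed.

Lemma gcomp_gt (M N : gbim) g (v : M) (y : N) :
  gcomp (gtens M N) g (v ⊗ y) = \sum_x gcomp M x v ⊗ gcomp N (x^-1 * g)%g y.
Proof. by rewrite mk_gcomp; exact: tprojE. Qed.

(** The first factor of T n.+1 becomes the first factor of the target, where phi
    is evaluated; the rest is rotated by the map for n. *)
Lemma rot_mapS n phi h g w (v : V) (y : T n) (psi : gdual V) :
  contract (T n) psi (@rot_map n.+1 phi h g w (v ⊗ y)) =
  #|K|%:R^-1 *: \sum_k \sum_x
    app phi (ract V k^-1%g (lact V h (gcomp V x v))) *: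
    @rot_map n psi k (x^-1 * g)%g w y.
Proof.
have [fl _ _] := gfunP (rotm n).
rewrite /rot_map exchange_big [X in lact _ h X]gcomp_gt linear_sum gt_suml !linear_sum.
apply: eq_bigr => x _ /=.
rewrite lact_bt rotSE contractE linearZ linear_sum /=; congr (_ *: _).
by apply: eq_bigr => k _; rewrite linearZ -fl lact_bt.
Qed.

Lemma rot_map0 phi h g w c :
  (@rot_map 0 phi h g w (lact (gunit C H) c (uone C H)) : CH) c =
  if g == sgval c then
    #|K|%:R^-1 * app phi (ract V c^-1%g (lact V (h * c)%g w)) else 0.
Proof.
have := lact_homog c (uone_homog C H); rewrite mulg1 => /gcompE cE.
rewrite /rot_map cE; case: eqP => _; last by rewrite linear0 gt0l !linear0 ffunE.
rewrite -lactM -uone_bal.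
have -> : gfun (rotm 0) (uone C H ⊗ lact V (h * c)%g w) = lact V (h * c)%g w ⊗ uone C H.
  rewrite rot0E; congr (_ ⊗ _); rewrite (bigD1 1%g) //= ffunE eqxx scale1r lact1.
  by rewrite big1 ?addr0 // => k k1; rewrite ffunE (negPf k1) scale0r.
rewrite contractE gunitZE gunit_sumE; congr (_ * _).
rewrite (bigD1 c) //= gunitZE uone_lact ffunE eqxx mulr1 big1 ?addr0 // => k kc.
by rewrite gunitZE uone_lact ffunE eq_sym (negPf kc) mulr0.
Qed.

(** Induction on n.  When the first factor of T n.+1 is traced out, a group element
    k in H and the degree x of that factor are summed over; for given k the
    degrees can match only for x = (a z a^-1) k with a = g z^-n, and then the
    elements of H that act combine to l = g z^-(n+1), whatever k is.  The sum over
    k thus compensates one factor 1 / |H|. *)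
Lemma ltrace_rot_map n phi h g z w : w \in homog V z ->
  ltrace (@rot_map n phi h g w) =
  if (g * z ^- n)%g \in H then
    #|K|%:R^-1 * app phi (ract V (subg H (g * z ^- n)%g)^-1%g
                     (lact V (h * subg H (g * z ^- n))%g w))
  else 0.
Proof.
move=> wz; elim: n phi h g => [|n IHn] phi h g.
  rewrite (ltrace_unit (@rot_map_linear 0 _ _ _ _)) expg0 invg1 mulg1.
  under eq_bigr do rewrite rot_map0.
  case: ifP => gH.
    rewrite (bigD1 (subg H g)) //= subgK // eqxx big1 ?addr0 // => c cg.
    by case: eqP => // gc; move: cg; rewrite gc sgvalK eqxx.
  by apply: big1 => c _; case: eqP => // gc; rewrite gc subgP in gH.
rewrite (ltrace_gtens (@rot_map_linear n.+1 _ _ _ _)).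
under eq_bigr => j _.
  rewrite (eq_ltrace (fun y => rot_mapS _ _ _ _ _ y _)) ltraceZ ltrace_sum.
  under eq_bigr => k _.
    rewrite ltrace_sum; under eq_bigr do rewrite ltraceZ IHn.
    over.
  over.
set l := (g * z ^- n.+1)%g; set a := (g * z ^- n)%g.
have la : l = (a * z^-1)%g by rewrite /l /a expgS invMg mulgA.
rewrite -mulr_sumr exchange_big /=.
transitivity (#|K|%:R^-1 * \sum_(k : K) if l \in H then
   #|K|%:R^-1 * app phi (ract V (subg H l)^-1%g (lact V (h * subg H l)%g w)) else 0); last first.
  by rewrite sumr_const -(mulr_natl (if _ then _ else _)) mulrA mulVf ?card_K_neq0 ?mul1r.
congr (_ * _); apply: eq_bigr => k _; rewrite exchange_big /=.
pose A x v := ract V k^-1%g (lact V h (gcomp V x v)).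
have AL x : linear (A x) by move=> c u v; rewrite /A !linearP.
pose L x := subg H (x^-1 * a)%g.
transitivity (\sum_x if (x^-1 * a)%g \in H then
    #|K|%:R^-1 * app phi (A x (ract V (L x)^-1%g (lact V (k * L x)%g w))) else 0).
  apply: eq_bigr => x _; rewrite -mulgA -/a -/(L x); case: ifP => xH; last first.
    by rewrite big1 // => j _; rewrite mulr0.
  rewrite -(dual_trace _ _ (AL x)) mulr_sumr; apply: eq_bigr => j _.
  by rewrite /A mulrCA.
clearbody a l.
(* The only degree x equal to that of (k L) w L^-1, where L = x^-1 a. *)
rewrite (bigD1 (a * z * a^-1 * sgval k)%g) //= big1 ?addr0 => [|x xk].
  have -> : ((a * z * a^-1 * sgval k)^-1 * a = sgval k^-1 * l)%g.
    by rewrite la !invMg invgK -!mulgA mulVg mulg1.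
  rewrite groupMl ?groupV ?subgP //; case: ifP => // lH; congr (_ * app phi _).
  have LE : L (a * z * a^-1 * sgval k)%g = (k^-1 * subg H l)%g.
    apply: val_inj; rewrite /= subgK.
      by rewrite subgK // la !invMg invgK -!mulgA mulVg mulg1.
    by rewrite !invMg invgK -!mulgA mulVg mulg1 -la groupMl ?groupV ?subgP.
  rewrite LE mulKVg invMg invgK; set u := ract V _ _.
  have ud : u \in homog V (a * z * a^-1 * sgval k)%g.
    have -> : (a * z * a^-1 * sgval k = (sgval (subg H l) * z) * sgval ((subg H l)^-1 * k))%g.
      by rewrite /= subgK // la !invMg invgK !mulgA mulgKV.
    exact/ract_homog/lact_homog.
  by rewrite /A (gcompE _ ud) eqxx /u -lractC -ractM mulgK lactM.
case: ifP => // xH; set u := ract V _ _.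
have ud : u \in homog V (sgval k * x^-1 * a * z * a^-1 * x)%g.
  have -> : (sgval k * x^-1 * a * z * a^-1 * x =
      (sgval (k * L x) * z) * sgval (L x)^-1)%g.
    by rewrite /= subgK // invMg invgK !mulgA.
  exact/ract_homog/lact_homog.
rewrite /A (gcompE _ ud); case: eqP => [E|_]; last by rewrite !linear0 mulr0.
case/eqP: xk.
have {E} /mulg1_eq : (sgval k * x^-1 * (a * z * a^-1) = 1)%g.
  by apply: (mulIg x); rewrite mul1g !mulgA -E.
by rewrite invMg invgK => <-; rewrite mulgKV.
Qed.
End RotationTrace.

(** * The indicator of an arbitrary object *)

Section IndicatorFormula.
Variables (C : numFieldType) (gT : finGroupType) (H : {group gT}).
Local Notation K := (subg_of H).
Local Notation gbim := (gbim C H).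
Local Notation D := (gbimod C H).
Local Notation "v ⊗ w" := (gt v w) (at level 40, left associativity).
Variable V : gbim.
Local Notation T n := (@tpow C D V n : gbim).

(** The trace of v |-> s v s^-1 on the homogeneous component of degree z, when that
    component is stable under it. *)
Definition conj_trace (z : gT) (s : K) : C :=
  ltrace (fun v => ract V s^-1%g (lact V s (gcomp V z v))).

Lemma turn_rot_map n phi (v : V) (y : T n) :
  contract (T n) phi (gfun (@rotm C gT H V n) (turn V (T n) (gcomp (gtens V (T n)) 1%g (v ⊗ y)))) =
  #|K|%:R^-1 *: \sum_h \sum_z
    rot_map phi h z^-1%g (ract V h^-1%g (gcomp V z v)) y.
Proof.
rewrite [X in turn _ _ X]gcomp_gt exchange_big !linear_sum.
apply: eq_bigr => z _ /=; rewrite mulg1 turnE !linearZ; congr (_ *: _) => /=.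
by rewrite !linear_sum.
Qed.

(** The rotation is traced over V (x) T n by [ltrace_gtens] and [ltrace_rot_map].
    The degree-1 condition pairs the degree z of the first factor with the degree
    z^-1 of the others.  After z is shifted by h, the map obtained on V is
    v |-> s v s^-1 with s = z^-m, conjugated by the right translation by h; the
    trace ignores this conjugation, and the sum over h cancels a factor 1 / |H|. *)
Lemma FS_indicatorE (j : pivotal D) m : piv' j V = spiv' V -> (0 < m)%N ->
  FS_indicator j m V =
  #|K|%:R^-1 * \sum_(z | (z ^+ m)%g \in H) conj_trace z (subg H (z ^- m)%g).
Proof.
move=> jV; case: m => // n _; rewrite /FS_indicator [n.+1.-1]/=.
rewrite [LHS](@ltrace_unit_hom C gT H (gtens V (T n)) _ (@FS_map_linear C D j V n)).
pose L (x : gtens V (T n)) : gtens V (T n) :=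
  gfun (@rotm C gT H V n) (turn V (T n) (gcomp (gtens V (T n)) 1%g x)).
have LL : linear L by move=> k x y; rewrite /L !linearP.
transitivity (ltrace L).
  apply: eq_ltrace => x; rewrite [LHS](FS_map_uone _ jV).
  by rewrite unit_map_uone turn_central.
rewrite (ltrace_gtens LL).
under eq_bigr => i _.
  rewrite (eq_ltrace (turn_rot_map _ _)) ltraceZ ltrace_sum.
  under eq_bigr => h _.
    rewrite ltrace_sum.
    under eq_bigr do rewrite (ltrace_rot_map _ _ _ _ (ract_homog _ (gcomp_in _ _))).
    over.
  over.
rewrite -mulr_sumr; congr (_ * _).
transitivity (\sum_(h : K) \sum_(z | (z ^+ n.+1)%g \in H)
    #|K|%:R^-1 * conj_trace z (subg H (z ^- n.+1)%g)); last first.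
  by rewrite -exchange_big /=; apply: eq_bigr => z _; rewrite sumr_const -(mulr_natl (_ * _))
    mulrA mulfV ?mul1r ?card_K_neq0.
rewrite exchange_big; apply: eq_bigr => h _ /=.
(* Shifting z to z h turns the vector (e_i)_z h^-1 into (e_i h^-1)_z. *)
rewrite exchange_big /= (reindex_inj (mulIg (sgval h))) [RHS]big_mkcond.
apply: eq_bigr => z _ /=.
have E : ((z * sgval h)^-1 * (z * sgval h * sgval h^-1) ^- n = sgval h^-1 * z ^- n.+1)%g.
  by rewrite mulgK invMg -mulgA expgSr invMg.
rewrite E groupMl ?groupV ?subgP //; case: ifP => zH; last by rewrite big1.
rewrite -mulr_sumr; congr (_ * _).
set s := subg H (z ^- n.+1)%g.
have -> : subg H (sgval h^-1 * z ^- n.+1)%g = (h^-1 * s)%g.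
  by apply: val_inj; rewrite /= /s !subgK // ?groupM ?groupV ?subgP.
rewrite mulKVg.
pose X v := ract V s^-1%g (lact V s (gcomp V z v)).
transitivity (ltrace ((ract V h \o X) \o ract V h^-1%g)).
  apply: eq_bigr => i _; rewrite cobasisE invMg invgK /= ractM /X.
  by have := gcomp_ract (z * sgval h)%g h^-1%g (vbasis {:V})`_i; rewrite /= mulgK => ->.
rewrite ltrace_cycle; try by move=> k u v; rewrite /X /= !linearP.
by apply: eq_ltrace => v /=; rewrite -ractM mulgV ract1.
Qed.

(** Conjugation by k carries the component of degree z to that of degree k z k^-1. *)
Lemma conj_traceJ z s (k : K) :
  conj_trace (sgval k * z * sgval k^-1)%g (k * s * k^-1)%g = conj_trace z s.
Proof.
pose X v := ract V s^-1%g (lact V s (gcomp V z v)).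
pose c v := ract V k^-1%g (lact V k v).
pose c' v := lact V k^-1%g (ract V k v).
transitivity (ltrace ((c \o X) \o c')).
  apply: eq_ltrace => v; rewrite /c /c' /X /=.
  have -> : gcomp V z (lact V k^-1%g (ract V k v)) =
      lact V k^-1%g (ract V k (gcomp V (sgval k * z * sgval k^-1)%g v)).
    by rewrite -gcomp_ract -gcomp_lact !mulgA mulgKV mulVg mul1g.
  by rewrite -lactM -[lact V k (ract _ _ _)]lractC -lactM mulgA -[lact V _ (ract V k _)]lractC
    -!ractM !invMg invgK mulgA.
rewrite ltrace_cycle; try by move=> a u v; rewrite /X /c /c' /= !linearP.
apply: eq_ltrace => v; rewrite /c /c' /X /=.
by rewrite -ractM mulVg ract1 -lactM mulVg lact1.
Qed.
End IndicatorFormula.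

(** * The objects with degrees in a double coset *)

Section CosetTrace.
Variables (C : numFieldType) (gT : finGroupType) (H : {group gT}).

Lemma coset_stab_mul d r : r \in (d *: H)%g -> coset_stab H d = coset_stab H r.
Proof.
move=> /lcosetP[h Hh ->]; apply/val_inj; rewrite /= invMg conjsgM; congr (_ :&: _).
by rewrite [(H :^ h^-1)%g]conjGid ?groupV.
Qed.

(** A power of r commutes with r, and S is also the intersection of H with its
    conjugate r H r^-1. *)
Lemma coset_stab_pow d r m : r \in (d *: H)%g ->
  ((r ^+ m)%g \in coset_stab H d) = ((r ^+ m)%g \in H).
Proof.
move=> rd; rewrite (coset_stab_mul rd) inE mem_conjgV.
by rewrite conjXg conjgE mulKg andbb.
Qed.

(** If z = a d b with a, b in H, then k^-1 z k is in dH exactly when k is in a S. *)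
Lemma card_conj_coset d z : z \in (H :* d * H)%g ->
  #|[pred k in H | (z ^ k)%g \in (d *: H)%g]| = #|coset_stab H d|.
Proof.
case/mulsgP => _ b /rcosetP[a Ha ->] Hb ->.
rewrite -(card_lcoset (coset_stab H d) a); apply: eq_card => k.
rewrite [RHS]mem_lcoset [RHS]inE mem_conjgV groupMl ?groupV // inE.
case Hk: (k \in H) => //=; rewrite mem_lcoset -[RHS]groupV.
have -> : (d^-1 * (a * d * b) ^ k = ((a^-1 * k) ^ d)^-1 * (b * k))%g.
  by rewrite !conjgE !invMg !invgK -!mulgA.
by rewrite groupMr // groupM.
Qed.

(** Count the pairs (k, z) with k in H and z^k in dH in two ways. *)
Lemma sum_class_coset d (F : gT -> C) :
  (forall k z, k \in H -> F (z ^ k)%g = F z) ->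
  (forall z, z \notin (H :* d * H)%g -> F z = 0) ->
  #|H|%:R^-1 * \sum_z F z = #|coset_stab H d|%:R^-1 * \sum_(r in (d *: H)%g) F r.
Proof.
move=> FJ F0.
have H0 : #|H|%:R != 0 :> C by rewrite pnatr_eq0 -lt0n cardG_gt0.
have S0 : #|coset_stab H d|%:R != 0 :> C by rewrite pnatr_eq0 -lt0n cardG_gt0.
apply: (mulfI H0); rewrite mulVKf //; apply: (mulfI S0).
rewrite (mulrCA _ _^-1) mulVKf //.
transitivity (\sum_z \sum_(k in H | (z ^ k)%g \in (d *: H)%g) F z).
  rewrite mulr_sumr; apply: eq_bigr => z _.
  case zD: (z \in (H :* d * H)%g); last first.
    by rewrite F0 ?zD // mulr0 big1.
  by rewrite sumr_const card_conj_coset // mulr_natl.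
rewrite (exchange_big_dep (mem H)) /=; last by move=> z k _ /andP[].
transitivity (\sum_(k in H) \sum_(r in (d *: H)%g) F r); last first.
  by rewrite sumr_const mulr_natl.
apply: eq_bigr => k Hk; rewrite (reindex_inj (conjg_inj k^-1%g)).
by apply: eq_big => [z|z _]; rewrite ?Hk ?conjgKV ?FJ ?groupV.
Qed.
End CosetTrace.

Section Fiber.
Variables (C : numFieldType) (gT : finGroupType) (H : {group gT}).
Variables (d : gT) (n : nat) (W : mx_representation C (coset_stab H d) n) (M : gbim C H).
Hypothesis FdM : is_Fd W M.

Lemma lift_coset_part r v : r \in (d *: H)%g -> v \in homog M r -> v \in coset_part d M.
Proof. by move=> rd vr; apply: (subvP (sumv_sup r rd (subvv _))). Qed.

Lemma quo_ract r k v : r \in (d *: H)%g -> v \in homog M r ->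
  quo (coset_rel d M) (ract M k v) = quo (coset_rel d M) v.
Proof.
move=> rd vr; apply/eqP; rewrite -subr_eq0 -linearB /= quo_eq0.
apply: (subvP (sumv_sup k isT (subvv _))).
have -> : ract M k v - v = (ract M k - \1)%VF v by rewrite add_lfunE opp_lfunE id_lfunE.
exact/memv_img/(lift_coset_part rd).
Qed.

(** The map v |-> sum_k (v k)_r kills all differences m k - m and is the identity on
    M_r, since v k has degree r only for k = 1. *)
Lemma coset_rel_homog r v : v \in homog M r -> v \in coset_rel d M -> v = 0.
Proof.
move=> vr; pose tau := (\sum_k (gcomp M r \o ract M k))%VF.
have tauE u : tau u = \sum_k gcomp M r (ract M k u).
  by rewrite sum_lfunE; apply: eq_bigr => k _; rewrite comp_lfunE.
have tauv : tau v = v.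
  rewrite tauE (bigD1 1%g) //= ract1 (gcompE _ vr) eqxx big1 ?addr0 // => k k1.
  rewrite (gcompE _ (ract_homog k vr)); case: eqP => // /eqP.
  rewrite -{1}[r]mulg1 (inj_eq (mulgI r)) => /eqP e.
  by case/eqP: k1; apply: val_inj.
rewrite -{2}tauv => vR; apply/eqP; rewrite -memv_ker.
apply: subvP vR; apply/subv_sumP => k _; apply/subvP => _ /memv_imgP[u _ ->].
rewrite memv_ker add_lfunE opp_lfunE id_lfunE linearB /= !tauE subr_eq0; apply/eqP.
by rewrite [RHS](reindex_inj (mulgI k)); apply: eq_bigr => h _; rewrite ractM.
Qed.

(** The right action of H permutes the components with degree in dH simply
    transitively, so that M_r maps isomorphically to (M_dH)/H.  In this quotient the right factor s^-1 disappears, so that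
    v |-> s v s^-1 becomes the action of s on W. *)
Lemma conj_trace_Fd r s : r \in (d *: H)%g -> s \in coset_stab H d ->
  (s * r = r * s)%g -> conj_trace M r (subg H s) = \tr (W s).
Proof.
move=> rd sS sr; have [_ [phi [phiQ phiI phiW]]] := FdM.
have Hs : s \in H by move: sS; rewrite inE => /andP[].
set Q := (quo _ @: _)%VS in phiQ phiI.
pose q : 'Hom(M, 'cV[C]_n) := (phi \o quo (coset_rel d M))%VF.
have qE v : q v = phi (quo (coset_rel d M) v) by rewrite comp_lfunE.
pose A := (q \o gcomp M r)%VF.
have AE v : A v = q (gcomp M r v) by rewrite comp_lfunE.
have Ainj v : A v = 0 -> gcomp M r v = 0.
  rewrite AE qE => q0; apply: (coset_rel_homog (gcomp_in r v)).
  rewrite -quo_eq0 -memv0 -phiI memv_cap memv_ker q0 eqxx andbT.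
  exact/memv_img/(lift_coset_part rd)/gcomp_in.
have Asurj x : x \in limg A.
  have : x \in (phi @: Q)%VS by rewrite phiQ memvf.
  case/memv_imgP => _ /memv_imgP[v /memv_sumP[u uh ->] ->] ->.
  (* Each component of degree g in dH is translated into M_r by g^-1 r in H. *)
  pose w := \sum_(g in (d *: H)%g) ract M (subg H (g^-1 * r)%g) (u g).
  apply/memv_imgP; exists w; first exact: memvf.
  have wr : w \in homog M r.
    apply: rpred_sum => g gd; have := ract_homog (subg H (g^-1 * r)%g) (uh g gd).
    rewrite subgK ?mulKVg //.
    by move: gd rd => /lcosetP[a Ha ->] /lcosetP[b Hb ->]; rewrite invMg -mulgA mulKg groupM ?groupV.
  have -> : A w = q w by rewrite AE (gcompE _ wr) eqxx.
  rewrite qE; congr (phi _); rewrite /w !linear_sum; apply: eq_bigr => g gd.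
  by rewrite /= (quo_ract _ gd) // uh.
pose sigma x := gcomp M r ((A^-1)%VF x).
have Asigma x : A (sigma x) = x.
  rewrite AE (gcompE _ (gcomp_in _ _)) eqxx -AE; exact: limg_lfunVK.
have sigmaA v : sigma (A v) = gcomp M r v.
  apply/eqP; rewrite -subr_eq0 -linearB /=; apply/eqP/Ainj.
  by rewrite linearB /= limg_lfunVK ?subrr // memv_img ?memvf.
pose X v := ract M (subg H s)^-1%g (lact M (subg H s) (gcomp M r v)).
have Xr v : X v \in homog M r.
  have := ract_homog (subg H s)^-1%g (lact_homog (subg H s) (gcomp_in r v)).
  by rewrite /= subgK // sr mulgK.
have XL : linear X by move=> k u v; rewrite /X !linearP.
have sL : linear sigma by move=> k u v; rewrite /sigma !linearP.
transitivity (ltrace (sigma \o (A \o X))).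
  by apply: eq_ltrace => v /=; rewrite sigmaA (gcompE _ (Xr v)) eqxx.
rewrite ltrace_cycle //; last by move=> k u v; rewrite /= XL linearP.
rewrite -ltrace_mx; apply: eq_ltrace => x /=.
rewrite AE (gcompE _ (Xr _)) eqxx qE /X (@quo_ract (s * r)%g).
- rewrite phiW //; last exact/(lift_coset_part rd)/gcomp_in.
  by rewrite -qE -AE Asigma.
- by move: rd; rewrite sr => /lcosetP[h Hh ->]; rewrite mem_lcoset -mulgA mulKg groupM.
by have := lact_homog (subg H s) (gcomp_in r (sigma x)); rewrite subgK.
Qed.
End Fiber.

(** * The indicator formula *)

Lemma FS_indicator_Fd (C : numClosedFieldType) (gT : finGroupType) (H : {group gT})
    (d : gT) (n : nat) (W : mx_representation C (coset_stab H d) n)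
    (M : gbim C H) (j : pivotal (gbimod C H)) (m : nat) :
  is_Fd W M -> canonical_pivotal j -> (0 < m)%N ->
  FS_indicator j m M =
    #|coset_stab H d|%:R^-1 *
    \sum_(r in (d *: H)%g | (r ^+ m)%g \in coset_stab H d) (\tr (W (r ^+ m)%g))^*.
Proof.
move=> FdM jc m0; rewrite (FS_indicatorE (canonical_pivotalE M jc) m0).
have -> : #|subg_of H| = #|H| by rewrite card_sub.
pose F z := if (z ^+ m)%g \in H then conj_trace M z (subg H (z ^- m)%g) else 0.
rewrite big_mkcond -/F (sum_class_coset (d := d) (F := F)).
- congr (_ * _); rewrite [RHS]big_mkcondr; apply: eq_bigr => r rd.
  rewrite /F -(coset_stab_pow m rd); case: ifP => // rS.
  rewrite (conj_trace_Fd FdM rd) ?groupV //; first exact: repr_trace_conj.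
  by apply: commute_sym; apply: commuteV; apply: commuteX.
- move=> k z Hk; rewrite /F -conjXg memJ_norm ?(subsetP (normG H)) //.
  case: ifP => // zH; rewrite -(conj_traceJ M z _ (subg H k^-1%g)) /=.
  rewrite subgK ?groupV // invgK -mulgA -conjgE; congr (conj_trace _ _ _).
  apply: val_inj; rewrite /= !subgK ?groupV //; last by rewrite memJ_norm ?(subsetP (normG H)).
  by rewrite -conjVg conjgE invgK mulgA.
move=> z zD; rewrite /F; case: ifP => // _.
rewrite /conj_trace (@eq_ltrace _ _ _ (fun v => 0 *: v)) ?ltraceZ ?mul0r // => v.
have [M0 _] := FdM; have := gcomp_in z v; rewrite M0 // memv0 => /eqP->.
by rewrite !linear0 scale0r.
Qed.

Theorem theorem4p1 (R : realType) (gT : finGroupType) (H : {group gT}) (d : gT)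
    (n : nat) (W : mx_representation R[i] (coset_stab H d) n)
    (M : gbim R[i] H) (j : pivotal (gbimod R[i] H)) (m : nat) :
  is_Fd W M -> canonical_pivotal j -> (0 < m)%N ->
  FS_indicator j m M =
    #|coset_stab H d|%:R^-1 *
    \sum_(r in (d *: H)%g | (r ^+ m)%g \in coset_stab H d) (\tr (W (r ^+ m)%g))^*
  /\
  FS_indicator j m M =
    #|coset_stab H d|%:R^-1 *
    \sum_(h in H | ((d * h) ^+ m)%g \in coset_stab H d)
      (\tr (W ((d * h) ^+ m)%g))^*.
Proof.
move=> FdM jc m0; have E := FS_indicator_Fd FdM jc m0.
split; first exact: E.
rewrite E; congr (_ * _); rewrite (reindex_inj (mulgI d)).
by apply: eq_bigl => h; rewrite mem_lcoset mulKg.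
Qed.
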